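(* Let $\Omega$ be a connected wsc on $[n]$ with a free action of a finite group $G$, let $d_0,\dots,d_n$ with $d_i=d_{gi}$ for all $g,i$, let $\epsilon>0$, and let $M\in\mathrm{Her}_{d_0\cdots d_n}$ be $G$-invariant. Then (a) if $1<p\le4/3$: $\displaystyle \operatorname{rank}^{\epsilon,p}_{(\Omega,G)}(M)\le\Big\lceil C_p\Big(\frac{2\mu_p(M)}{\epsilon}\Big)^{\frac p{p-1}}\Big\rceil\cdot|G|$; (b) if $p=2$ or $4\le p<\infty$: $\displaystyle \operatorname{rank}^{\epsilon,p}_{(\Omega,G)}(M)\le\Big\lceil D_p\Big(\frac{2\mu_p(M)}{\epsilon}\Big)^{2}\Big\rceil\cdot|G|$, where $C_p=(2e^2/p^{1/p})^{p/(p-1)}$ and $D_p=2(p-1)e^4$.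
   Context: Weighted simplicial complexes: for $[n]=\{0,\dots,n\}$ with power set $\mathcal P_n$, a wsc is a function $\Omega:\mathcal P_n\to\mathbb N_0$ such that $S_1\subseteq S_2$ implies $\Omega(S_1)$ divides $\Omega(S_2)$; $S$ is a simplex if $\Omega(S)\ne0$, and every singleton is assumed to be a simplex. Facets are inclusion-maximal simplices; $\mathcal F$ is the set of facets, $\widetilde{\mathcal F}$ the multiset containing each facet $F$ exactly $\Omega(F)$ times, with collapse map $c:\widetilde{\mathcal F}\to\mathcal F$, and $\widetilde{\mathcal F}_i$ the sub-multiset of elements whose underlying facet contains $i$. Vertices $i,j$ are neighbours if some facet contains both; $\Omega$ is connected if the neighbour graph on $[n]$ is connected. An action of $G$ on $\Omega$ is an action of $G$ on $[n]$ with $\Omega(gS)=\Omega(S)$ for all $S\in\mathcal P_n$, $g\in G$ (where $gS=\{gs:s\in S\}$), together with an action of $G$ on $\widetilde{\mathcal F}$ such that $c(gF)=g\,c(F)$; it is free if the action on $\widetilde{\mathcal F}$ is free. $(\Omega,G)$-decompositions: given vector spaces $\mathcal V_i$ with $\mathcal V_i=\mathcal V_{gi}$, $G$ acts on $\mathcal V=\mathcal V_0\otimes\cdots\otimes\mathcal V_n$ by $g(v^{[0]}\otimes\cdots\otimes v^{[n]})=v^{[g0]}\otimes\cdots\otimes v^{[gn]}$; $v$ is $G$-invariant if $gv=v$ for all $g$. For a finite set $\mathcal I$ and $\alpha\in\mathcal I^{\widetilde{\mathcal F}}$ (functions $\widetilde{\mathcal F}\to\mathcal I$) write $\alpha_{|i}$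 for its restriction to $\widetilde{\mathcal F}_i$. An $(\Omega,G)$-decomposition of $v\in\mathcal V$ is a finite $\mathcal I$ and vectors $v^{[i]}_\beta\in\mathcal V_i$ ($i\in[n]$, $\beta\in\mathcal I^{\widetilde{\mathcal F}_i}$) with $v=\sum_{\alpha\in\mathcal I^{\widetilde{\mathcal F}}}v^{[0]}_{\alpha_{|0}}\otimes\cdots\otimes v^{[n]}_{\alpha_{|n}}$ and $v^{[i]}_\beta=v^{[gi]}_{{}^g\beta}$ for all $i,g,\beta$, where ${}^g\beta\in\mathcal I^{\widetilde{\mathcal F}_{gi}}$, ${}^g\beta(F)=\beta(g^{-1}F)$. $\operatorname{rank}_{(\Omega,G)}(v)$ is the minimal $|\mathcal I|$ over all such decompositions ($\infty$ if none). Matrix setting: $\mathcal V_i=\mathcal M_{d_i}$ (complex $d_i\times d_i$ matrices), $\mathcal V\cong\mathcal M_{d_0\cdots d_n}$, $\mathrm{Her}$ the Hermitian matrices, $\|\cdot\|_p$ the Schatten $p$-norm $(\sum_i s_i^p)^{1/p}$. Approximate rank: $\operatorname{rank}^{\epsilon,p}_{(\Omega,G)}(M)=\min\{\operatorname{rank}_{(\Omega,G)}(N):N\in\mathcal M_{d_0\cdots d_n},\|M-N\|_p\le\epsilon\}$. Gauge: $P_p=\{\pm\rho^{[0]}\otimes\cdots\otimes\rho^{[n]}:\rho^{[i]}\text{ psd in }\mathcal M_{d_i},\ \|\rho^{[0]}\otimes\cdots\otimes\rho^{[n]}\|_p\le1\}$, $B_p=\operatorname{conv}(P_p)$, $\mu_p(v)=\inf\{\lambda>0:v/\lambda\in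 B_p\}$. *)

(* Defs.v *)
From HB Require Import structures.
From mathcomp Require Import all_boot all_order all_algebra all_fingroup.
From mathcomp Require Import all_classical all_reals all_analysis.
From mathcomp Require Import complex.
Set Implicit Arguments. Unset Strict Implicit. Unset Printing Implicit Defensive.
Import Order.TTheory GRing.Theory Num.Theory.
Local Open Scope ring_scope.

Section WSC.
Variable n : nat.
Implicit Types (Om : {set 'I_n.+1} -> nat).

Definition is_wsc Om :=
  (forall S1 S2 : {set 'I_n.+1}, S1 \subset S2 -> (Om S1 %| Om S2)%N) /\
  (forall i : 'I_n.+1, Om [set i] != 0%N).

Definition is_simplex Om (S : {set 'I_n.+1}) : bool := Om S != 0%N.

Definition is_facet Om (F : {set 'I_n.+1}) : bool :=
  is_simplex Om F &&
  [forall S : {set 'I_n.+1}, (is_simplex Om S && (F \subset S)) ==> (S == F)].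

Definition neighbours Om : rel 'I_n.+1 :=
  fun i j => [exists F : {set 'I_n.+1}, [&& is_facet Om F, i \in F & j \in F]].

Definition wsc_connected Om := forall i j : 'I_n.+1, connect (neighbours Om) i j.

(* (Ft, c) represents the multiset  \tilde F  (each facet F appearing exactly
   Omega(F) times) together with its collapse map c : \tilde F -> F.     *)
Definition facet_multiset Om (Ft : finType) (c : Ft -> {set 'I_n.+1}) :=
  forall F : {set 'I_n.+1},
    #|[set x : Ft | c x == F]| = (if is_facet Om F then Om F else 0%N).

Definition is_left_action (gT : finGroupType) (T : Type) (a : gT -> T -> T) :=
  (forall x, a 1%g x = x) /\ (forall g h x, a (g * h)%g x = a g (a h x)).

Definition wsc_action Om (gT : finGroupType) (ai : gT -> 'I_n.+1 -> 'I_n.+1)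
    (Ft : finType) (c : Ft -> {set 'I_n.+1}) (aF : gT -> Ft -> Ft) :=
  [/\ is_left_action ai,
      (forall g (S : {set 'I_n.+1}), Om (ai g @: S) = Om S),
      is_left_action aF &
      (forall g x, c (aF g x) = ai g @: c x)].

Definition free_action (gT : finGroupType) (Ft : finType) (aF : gT -> Ft -> Ft) :=
  forall g x, aF g x = x -> g = 1%g.
End WSC.

(* Matrices: V = M_{d_0} (x) ... (x) M_{d_n}, identified with square   *)
(* matrices indexed by multi-indices {dffun forall i, 'I_(d i)}          *)
(* (enumerated by enum_val).                                           *)
Notation mindex n d := {dffun forall i : 'I_n.+1, 'I_(d i)}.

Section Matrices.
Variable R : realType.
Local Notation C := R[i].
Local Notation rC x := (real_complex R x).

Definition adjmx m (A : 'M[C]_m) : 'M[C]_m := (map_mx Num.conj A)^T.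

Definition is_hermitian m (A : 'M[C]_m) := adjmx A = A.

Definition is_psd m (A : 'M[C]_m) :=
  forall x : 'cV[C]_m, 0 <= ((map_mx Num.conj x)^T *m A *m x) 0 0.

Definition unitary m (U : 'M[C]_m) := U *m adjmx U = 1%:M.

Definition singular_values m (A : 'M[C]_m) (s : 'I_m -> R) :=
  (forall i, 0 <= s i) /\
  exists U V : 'M[C]_m, [/\ unitary U, unitary V &
     A = U *m diag_mx (\row_i rC (s i)) *m adjmx V].

(* Schatten p-norm  (sum_i s_i^p)^(1/p)  (the set below is a singleton) *)
Definition schatten m (p : R) (A : 'M[C]_m) : R :=
  inf [set (\sum_i powR (s i) p) `^ p^-1 | s in [set s | singular_values A s]].

Variable n : nat.
Variable d : 'I_n.+1 -> nat.

Definition tens (rho : forall i : 'I_n.+1, 'M[C]_(d i)) : 'M[C]_#|mindex n d| :=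
  \matrix_(a, b) \prod_(i < n.+1)
     rho i ((enum_val a : mindex n d) i) ((enum_val b : mindex n d) i).

(* N = g . M for the action g(v^[0] (x) .. (x) v^[n]) = v^[g0] (x) .. (x) v^[gn],
   extended linearly; in coordinates (gM)(j,k) = M(j o g^-1, k o g^-1). *)
Definition mx_act_rel (gT : finGroupType) (ai : gT -> 'I_n.+1 -> 'I_n.+1) (g : gT)
    (M N : 'M[C]_#|mindex n d|) :=
  forall a b a' b' : 'I_#|mindex n d|,
    (forall i, ((enum_val a' : mindex n d) i : nat)
                 = (enum_val a : mindex n d) (ai g^-1%g i)) ->
    (forall i, ((enum_val b' : mindex n d) i : nat)
                 = (enum_val b : mindex n d) (ai g^-1%g i)) ->
    N a b = M a' b'.

Definition G_invariant (gT : finGroupType) (ai : gT -> 'I_n.+1 -> 'I_n.+1)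
    (M : 'M[C]_#|mindex n d|) :=
  forall g : gT, mx_act_rel ai g M M.

Section Decomp.
Variables (gT : finGroupType) (ai : gT -> 'I_n.+1 -> 'I_n.+1).
Variables (Ft : finType) (c : Ft -> {set 'I_n.+1}) (aF : gT -> Ft -> Ft).

Definition restr k (alpha : {ffun Ft -> 'I_k}) (i : 'I_n.+1)
  : {ffun {x : Ft | i \in c x} -> 'I_k} := [ffun x => alpha (val x)].

Definition is_decomp k
    (v : forall i : 'I_n.+1, {ffun {x : Ft | i \in c x} -> 'I_k} -> 'M[C]_(d i))
    (N : 'M[C]_#|mindex n d|) :=
  N = \sum_(alpha : {ffun Ft -> 'I_k}) tens (fun i => v i (restr alpha i)) /\
  (* v^[i]_beta = v^[gi]_(^g beta), where ^g beta (F) = beta (g^-1 F) *)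
  (forall (i : 'I_n.+1) (g : gT) (beta : {ffun {x : Ft | i \in c x} -> 'I_k})
          (beta' : {ffun {x : Ft | ai g i \in c x} -> 'I_k}),
     (forall (x : {x : Ft | i \in c x}) (y : {x : Ft | ai g i \in c x}),
         val y = aF g (val x) -> beta' y = beta x) ->
     forall (r s : 'I_(d i)) (r' s' : 'I_(d (ai g i))),
       (r : nat) = r' -> (s : nat) = s' -> v i beta r s = v (ai g i) beta' r' s').

(* rank_(Omega,G): minimal |I|, +oo if no decomposition *)
Definition rankOG (N : 'M[C]_#|mindex n d|) : \bar R :=
  ereal_inf [set ((k%:R : R)%:E) | k in [set k : nat | exists v, is_decomp (k:=k) v N]].

Definition approx_rankOG (eps p : R) (M : 'M[C]_#|mindex n d|) : \bar R :=
  ereal_inf [set rankOG N | N in [set N | schatten p (M - N) <= eps]].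
End Decomp.

Definition Pp (p : R) : set 'M[C]_#|mindex n d| :=
  [set X | exists (b : bool) (rho : forall i : 'I_n.+1, 'M[C]_(d i)),
     [/\ forall i, is_psd (rho i), schatten p (tens rho) <= 1 &
         X = (-1) ^+ b *: tens rho]].

Definition Bp (p : R) : set 'M[C]_#|mindex n d| :=
  [set X | exists (k : nat) (w : 'I_k -> R) (P : 'I_k -> 'M[C]_#|mindex n d|),
     [/\ forall j, 0 <= w j, \sum_j w j = 1, forall j, Pp p (P j) &
         X = \sum_j rC (w j) *: P j]].

Definition mu (p : R) (M : 'M[C]_#|mindex n d|) : R :=
  inf [set l : R | 0 < l /\ Bp p (rC l^-1 *: M)].
End Matrices.

Definition Cp (R : realType) (p : R) : R :=
  powR (2 * expR 1 ^+ 2 / powR p p^-1) (p / (p - 1)).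
Definition Dp (R : realType) (p : R) : R := 2 * (p - 1) * expR 1 ^+ 4.

(* Main.v *)
Require Import Defs.
From HB Require Import structures.
From mathcomp Require Import all_boot all_order all_algebra all_fingroup.
From mathcomp Require Import all_classical all_reals all_analysis.
From mathcomp Require Import complex ring lra.
Import Order.TTheory GRing.Theory Num.Theory.
Local Open Scope ring_scope.
Set Implicit Arguments. Unset Strict Implicit. Unset Printing Implicit Defensive.

(** A derandomised Maurey argument.  Choose l <= 2 mu_p(M) such that
    X = M / l is a convex combination of points P_j of P_p.  Whatever the current
    sum S of deviations P_j - X is, some j makes the derivative of Tr|.|^p at S
    in the direction P_j - X nonpositive, since these directions average to 0;
    adding that deviation lets ||S||_p grow only at the rate allowed by the
    smoothness of Tr|.|^p.  After K steps the average of the selected P_j is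
    close to X.

    Smoothness is obtained by comparing eigenbases u_i of A and v_j of B: all
    trace expressions become sums of scalar ones against the doubly stochastic
    weights |<u_i, v_j>|^2.  For p >= 2 the scalar second-order remainder of
    |t|^p is summed with Hoelder's inequality, using
    |<u_i, v_j>|^2 (b_j - a_i)^2 = |<u_i, (B - A) v_j>|^2.  For p < 2 one proves
    Clarkson's inequality in the eigenbasis of X^2 + Y^2.

    Averaging over G does not increase the distance to the invariant M.  An
    orbit sum of an elementary tensor needs only |G| indices: a free action
    admits an equivariant map from the facets to G, whose left translates serve
    as the labellings, and connectedness forces all vertices to use the same
    translate.  The constants C_p and D_p are generous enough for l <= 2 mu_p(M),
    so the infimum defining mu_p(M) need not be attained. *)

(** * Tangent-line inequalities for powers *)

Section ScalarInequalities.
Variable R : realType.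
Implicit Types (a b t u r p q : R).

(** Young's inequality for the product $t^r \cdot 1$ with exponents $1/r$ and $1/(1-r)$. *)
Lemma powR_le_tangent1 r t : 0 < r <= 1 -> 0 <= t -> t `^ r <= 1 + r * (t - 1).
Proof.
case/andP=> r0; rewrite le_eqVlt => /orP[/eqP -> t0|r1 t0].
  by rewrite powRr1//; lra.
have := @conjugate_powR _ (t `^ r) 1 r^-1 (1 - r)^-1 (powR_ge0 _ _) ler01.
rewrite !invrK -powRrM mulfV ?gt_eqF// powRr1// powR1 mulr1.
have r10 : 0 < 1 - r by lra.
rewrite !invr_gt0 => /(_ r0 r10) H.
by apply: le_trans (H _) _; [ring|lra].
Qed.

Lemma powR_ge_tangent1 r t : 1 <= r -> 0 <= t -> 1 + r * (t - 1) <= t `^ r.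
Proof.
move=> r1 t0; have r0 : 0 < r by lra.
have := @powR_le_tangent1 r^-1 (t `^ r).
rewrite -powRrM mulfV ?gt_eqF// powRr1// invr_gt0 r0 invf_le1// => /(_ r1 (powR_ge0 _ _)).
rewrite -(ler_pM2l r0) mulrDr mulrA mulfV ?gt_eqF//; lra.
Qed.

Lemma powR_tangentE r u t : 0 < u -> 0 <= t ->
  u `^ r * (t / u) `^ r = t `^ r /\
  u `^ r * (1 + r * (t / u - 1)) = u `^ r + r * u `^ (r - 1) * (t - u).
Proof.
move=> u0 t0; split.
  by rewrite -powRM ?divr_ge0// ?ltW// mulrCA mulfV ?gt_eqF// mulr1.
rewrite powRB ?(gt_eqF u0) ?implybT// (powRr1 (ltW u0)); field; exact: lt0r_neq0.
Qed.

Lemma powR_le_tangent r u t : 0 < r <= 1 -> 0 < u -> 0 <= t ->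
  t `^ r <= u `^ r + r * u `^ (r - 1) * (t - u).
Proof.
move=> r01 u0 t0; have [<- <-] := powR_tangentE r u0 t0.
by rewrite ler_wpM2l ?powR_ge0// powR_le_tangent1// divr_ge0// ltW.
Qed.

Lemma powR_ge_tangent r u t : 1 <= r -> 0 <= u -> 0 <= t ->
  u `^ r + r * u `^ (r - 1) * (t - u) <= t `^ r.
Proof.
move=> r1; rewrite le_eqVlt => /orP[/eqP <- t0|u0 t0].
  rewrite powR0 ?add0r ?subr0; last by rewrite gt_eqF//; lra.
  (* At u = 0 the convention $0^0 = 1$ makes the slope 1 when r = 1 and 0 when r > 1. *)
  move: r1; rewrite le_eqVlt => /orP[/eqP <-|r1].
    by rewrite subrr powRr0 powRr1// !mul1r.
  by rewrite powR0 ?subr_eq0 ?gt_eqF// mulr0 mul0r powR_ge0.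
have [<- <-] := powR_tangentE r u0 t0.
by rewrite ler_wpM2l ?powR_ge0// powR_ge_tangent1// divr_ge0// ltW.
Qed.

(** The odd power function; [p * spowR (p - 1) t] is the derivative of $|t|^p$. *)
Definition spowR q t : R := Num.sg t * `|t| `^ q.

Lemma spowR_normM q t : 0 < q -> spowR q t * t = `|t| `^ (q + 1).
Proof.
move=> q0; rewrite /spowR mulrAC -[_ * t]normrEsg -[q in LHS](addrK 1).
by rewrite mulr_powRB1// addr_gt0.
Qed.

Lemma spowRN q t : spowR q (- t) = - spowR q t.
Proof. by rewrite /spowR sgrN normrN mulNr. Qed.

Lemma ler_spowR q t : spowR q t <= `|t| `^ q.
Proof.
rewrite /spowR; case: (sgrP t) => _; rewrite ?mul0r ?mul1r ?powR_ge0//.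
by rewrite mulN1r ge0_cp// powR_ge0.
Qed.

Lemma normr_spowR q t : `|spowR q t| <= `|t| `^ q.
Proof.
by rewrite ler_norml lerNl -spowRN -{1}(normrN t) !ler_spowR.
Qed.

Lemma normr_powR_ge_tangent p a b : 1 < p ->
  `|a| `^ p + p * spowR (p - 1) a * (b - a) <= `|b| `^ p.
Proof.
move=> p1; have p0 : 0 < p by lra.
apply: le_trans (powR_ge_tangent (ltW p1) (normr_ge0 a) (normr_ge0 b)).
rewrite lerD2l -![p * _ * _]mulrA ler_pM2l// !mulrBr.
rewrite (spowR_normM _ _) ?subr_gt0// subrK [`|a| `^ _ * `|a|]mulrC mulr_powRB1//.
rewrite lerD2r; apply: le_trans (ler_norm _) _.
by rewrite normrM ler_wpM2r// normr_spowR.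
Qed.

(** For equal signs the tangent to $t^q$ at the point of larger modulus bounds the increment; for
    opposite signs the two terms are estimated separately. The two powers stay apart so that each
    can later be summed in its own eigenbasis. *)
Lemma spowR_monotone_bound q a b : 1 <= q ->
  (spowR q b - spowR q a) * (b - a) <=
    q * (`|a| `^ (q - 1) + `|b| `^ (q - 1)) * (b - a) ^+ 2.
Proof.
move=> q1.
have q0 : 0 < q by lra.
have same (x y : R) : 0 <= x -> x <= y ->
    (spowR q y - spowR q x) * (y - x) <=
    q * (`|x| `^ (q - 1) + `|y| `^ (q - 1)) * (y - x) ^+ 2.
  move=> x0 xy; have y0 := le_trans x0 xy.
  have sE z : 0 <= z -> spowR q z = z `^ q.
    rewrite /spowR le_eqVlt => /orP[/eqP <-|z0].
      by rewrite sgr0 mul0r powR0// gt_eqF.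
    by rewrite gtr0_sg// mul1r gtr0_norm.
  rewrite !sE// !ger0_norm//.
  have H := powR_ge_tangent q1 y0 x0.
  have := powR_ge0 x (q - 1); have := powR_ge0 y (q - 1).
  set X := x `^ (q - 1); set Y := y `^ (q - 1) => Y0 X0.
  rewrite expr2 mulrA ler_wpM2r ?subr_ge0//.
  have : 0 <= q * X * (y - x) by rewrite !mulr_ge0 ?subr_ge0// ltW.
  by move: H; rewrite -/Y; lra.
have opp (x y : R) : 0 <= x -> 0 <= y ->
    (spowR q y - spowR q (- x)) * (y - - x) <=
    q * (`|- x| `^ (q - 1) + `|y| `^ (q - 1)) * (y - - x) ^+ 2.
  move=> x0 y0; rewrite spowRN !opprK normrN.
  rewrite expr2 mulrA ler_wpM2r ?addr_ge0//.
  have Hx := ler_spowR q x; have Hy := ler_spowR q y.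
  rewrite !ger0_norm// in Hx Hy *.
  have := powR_ge0 x (q - 1); have := powR_ge0 y (q - 1).
  rewrite -(mulr_powRB1 x0 q0) -(mulr_powRB1 y0 q0) in Hx Hy.
  move: Hx Hy; set X := x `^ (q - 1); set Y := y `^ (q - 1) => Hx Hy Y0 X0.
  apply: le_trans (lerD Hy Hx) _.
  have q1' : 0 <= q - 1 by lra.
  have : 0 <= (q - 1) * ((X + Y) * (y + x)) by rewrite mulr_ge0// mulr_ge0// addr_ge0.
  have : 0 <= X * y by rewrite mulr_ge0.
  have : 0 <= Y * x by rewrite mulr_ge0.
  lra.
have flip (x y : R) : (spowR q (- y) - spowR q (- x)) * (- y - - x)
    = (spowR q y - spowR q x) * (y - x).
  by rewrite !spowRN; ring.
have flip2 (x y : R) : (- y - - x) ^+ 2 = (y - x) ^+ 2 by ring.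
have swap (x y : R) : (spowR q y - spowR q x) * (y - x)
    = (spowR q x - spowR q y) * (x - y) by ring.
have swap2 (x y : R) : (y - x) ^+ 2 = (x - y) ^+ 2 by ring.
have [a0|/ltW a0] := leP 0 a; have [b0|/ltW b0] := leP 0 b.
- have [ab|/ltW ba] := leP a b; first exact: same.
  by rewrite swap swap2 (addrC (`|a| `^ _)); exact: same.
- rewrite swap swap2 (addrC (`|a| `^ _)) -[b]opprK; apply: opp => //.
  by rewrite oppr_ge0.
- by rewrite -[a]opprK; apply: opp => //; rewrite oppr_ge0.
- rewrite -flip -flip2 -(normrN a) -(normrN b).
  have [ab|/ltW ba] := leP a b.
    rewrite swap swap2 (addrC (`|- a| `^ _)); apply: same; lra.
  apply: same; lra.
Qed.

(** The tangent at b bounds $|b|^p - |a|^p$ by the derivative at b times b - a; replacing that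
    derivative by the one at a costs what [spowR_monotone_bound] allows for q = p - 1. *)
Lemma normr_powR_le_tangent p a b : 2 <= p ->
  `|b| `^ p <= `|a| `^ p + p * spowR (p - 1) a * (b - a)
    + p * (p - 1) * (`|a| `^ (p - 2) + `|b| `^ (p - 2)) * (b - a) ^+ 2.
Proof.
move=> p2; have p1 : 1 < p by lra.
have := normr_powR_ge_tangent b a p1.
have q1 : 1 <= p - 1 by lra.
have := spowR_monotone_bound a b q1.
have -> : p - 1 - 1 = p - 2 by ring.
have p0 : 0 <= p by lra.
move=> /(ler_wpM2l p0).
set X := `|a| `^ (p - 2) + `|b| `^ (p - 2); lra.
Qed.

(* Young's inequality in a form whose sum over doubly stochastic weights is
   Hoelder's inequality for the exponents p/(p-2) and p/2. *)
Lemma young_powR p s t al et : 2 <= p -> 0 < al -> 0 < et -> 0 <= s -> 0 <= t ->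
  s `^ (p - 2) * t ^+ 2 <= al `^ (p - 2) * et ^+ 2 *
    ((p - 2) / p * (s `^ p / al `^ p) + 2 / p * (t `^ p / et `^ p)).
Proof.
move=> p2 al0 et0 s0 t0.
have sqrE (x : R) : 0 <= x -> x ^+ 2 = x `^ 2 by move=> ?; rewrite -powR_mulrn.
set x := s / al; set y := t / et.
have x0 : 0 <= x by rewrite divr_ge0// ltW.
have y0 : 0 <= y by rewrite divr_ge0// ltW.
have p0 : 0 < p by lra.
have p21 : 1 <= p / 2 by lra.
(* In the normalised variables the claim is the tangent to $z^{p/2}$ at $x^2$, evaluated at
   $y^2$. *)
have := powR_ge_tangent p21 (sqr_ge0 x) (sqr_ge0 y).
have sqP (z r : R) : 0 <= z -> (z ^+ 2) `^ r = z `^ (2 * r).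
  by move=> z0; rewrite sqrE// -powRrM.
rewrite !sqP//.
have -> : 2 * (p / 2) = p by field.
have -> : 2 * (p / 2 - 1) = p - 2 by field.
move=> H.
have dv (u v r : R) : 0 <= u -> 0 < v -> (u / v) `^ r = u `^ r / v `^ r.
  move=> u0 v0; rewrite powRM ?invr_ge0 ?(ltW v0)//.
  by rewrite -powR_inv1 ?ltW// -powRrM mulN1r powRN.
rewrite -!dv// -/x -/y.
have -> : s `^ (p - 2) * t ^+ 2 = al `^ (p - 2) * et ^+ 2 * (x `^ (p - 2) * y ^+ 2).
  rewrite /x /y dv// expr_div_n; field.
  by rewrite !gt_eqF// powR_gt0.
apply: ler_wpM2l; first by rewrite mulr_ge0// ?powR_ge0// sqr_ge0.
have E : x `^ (p - 2) * x ^+ 2 = x `^ p.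
  have [->|xn0] := eqVneq x 0.
    by rewrite expr0n /= mulr0 powR0// gt_eqF.
  by rewrite sqrE// -powRD ?subrK// xn0 implybT.
have {}H : x `^ p - p / 2 * x `^ p + p / 2 * (x `^ (p - 2) * y ^+ 2) <= y `^ p.
  rewrite -[in X in _ - X]E; apply: le_trans H; lra.
have h0 : 0 < 2^-1 :> R by rewrite invr_gt0.
rewrite -(ler_pM2l p0) -(ler_pM2l h0).
have -> : 2^-1 * (p * ((p - 2) / p * x `^ p + 2 / p * y `^ p)) =
  (p - 2) / 2 * x `^ p + y `^ p by field; rewrite gt_eqF.
lra.
Qed.

End ScalarInequalities.

(** * Hermitian matrices and overlaps of eigenbases *)

Section SpectralWeights.
Variable R : realType.
Local Notation C := R[i].
Local Notation rC x := (real_complex R x).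

Definition abs2 (z : C) : R := complex.Re z ^+ 2 + complex.Im z ^+ 2.

Lemma abs2_ge0 z : 0 <= abs2 z.
Proof. by rewrite addr_ge0 ?sqr_ge0. Qed.

Lemma abs2E z : rC (abs2 z) = z * Num.conj z.
Proof. by rewrite add_Re2_Im2 normCK. Qed.

Lemma abs2M z1 z2 : abs2 (z1 * z2) = abs2 z1 * abs2 z2.
Proof. by case: z1 z2 => [x1 y1] [x2 y2]; rewrite /abs2 /=; ring. Qed.

Lemma abs2_conj z : abs2 (Num.conj z) = abs2 z.
Proof. by case: z => x y; rewrite /abs2 /= sqrrN. Qed.

Lemma abs2_real x : abs2 (rC x) = x ^+ 2.
Proof. by rewrite /abs2 /= expr0n addr0. Qed.

Lemma conj_real x : Num.conj (rC x) = rC x.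
Proof. exact: conjc_real. Qed.

Lemma ReD (x y : C) : complex.Re (x + y) = complex.Re x + complex.Re y.
Proof. by case: x y => [? ?] [? ?]. Qed.

Lemma Re_sum I (r : seq I) (P : pred I) (F : I -> C) :
  complex.Re (\sum_(i <- r | P i) F i) = \sum_(i <- r | P i) complex.Re (F i).
Proof. exact: (big_morph _ ReD). Qed.

Lemma Re_realM x (z : C) : complex.Re (rC x * z) = x * complex.Re z.
Proof. by case: z => a b /=; rewrite mul0r subr0. Qed.

Variable m : nat.
Implicit Types (A B X Y U V Z : 'M[C]_m) (a b y : 'I_m -> R).

Lemma adjmxE A i j : adjmx A i j = Num.conj (A j i).
Proof. by rewrite !mxE. Qed.

Lemma adjmxM A B : adjmx (A *m B) = adjmx B *m adjmx A.
Proof. by rewrite /adjmx map_mxM trmx_mul. Qed.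

Lemma adjmxK A : adjmx (adjmx A) = A.
Proof. by apply/matrixP => i j; rewrite !adjmxE conjCK. Qed.

Lemma adjmxD A B : adjmx (A + B) = adjmx A + adjmx B.
Proof. by apply/matrixP => i j; rewrite !mxE rmorphD. Qed.

Lemma adjmxN A : adjmx (- A) = - adjmx A.
Proof. by apply/matrixP => i j; rewrite !mxE rmorphN. Qed.

Lemma adjmxZ x A : adjmx (rC x *: A) = rC x *: adjmx A.
Proof. by apply/matrixP => i j; rewrite !mxE rmorphM /= conj_real. Qed.

Lemma adjmx0 : adjmx (0 : 'M[C]_m) = 0.
Proof. by apply/matrixP => i j; rewrite !mxE rmorph0. Qed.

Lemma hermitianD A B : is_hermitian A -> is_hermitian B -> is_hermitian (A + B).
Proof. by move=> hA hB; rewrite /is_hermitian adjmxD hA hB. Qed.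

Lemma hermitianN A : is_hermitian A -> is_hermitian (- A).
Proof. by move=> hA; rewrite /is_hermitian adjmxN hA. Qed.

Lemma hermitianB A B : is_hermitian A -> is_hermitian B -> is_hermitian (A - B).
Proof. by move=> hA hB; apply/hermitianD/hermitianN. Qed.

Lemma hermitianZ x A : is_hermitian A -> is_hermitian (rC x *: A).
Proof. by move=> hA; rewrite /is_hermitian adjmxZ hA. Qed.

Lemma hermitian0 : is_hermitian (0 : 'M[C]_m).
Proof. exact: adjmx0. Qed.

Lemma hermitian_sum I (r : seq I) (P : pred I) (F : I -> 'M[C]_m) :
  (forall i, P i -> is_hermitian (F i)) -> is_hermitian (\sum_(i <- r | P i) F i).
Proof. by move=> h; elim/big_ind: _ => //; [exact: hermitian0|exact: hermitianD]. Qed.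

Definition rdiag a : 'M[C]_m := diag_mx (\row_i rC (a i)).

Lemma adjmx_rdiag a : adjmx (rdiag a) = rdiag a.
Proof.
apply/matrixP => i j; rewrite adjmxE !mxE eq_sym; case: eqVneq => [->|_].
  by rewrite !mulr1n conj_real.
by rewrite !mulr0n rmorph0.
Qed.

Lemma mul_rdiag a X i j : (rdiag a *m X) i j = rC (a i) * X i j.
Proof. by rewrite mul_diag_mx !mxE. Qed.

Lemma mulmx_rdiag a X i j : (X *m rdiag a) i j = X i j * rC (a j).
Proof. by rewrite mul_mx_diag !mxE. Qed.

Definition eig A U a := unitary U /\ A = U *m rdiag a *m adjmx U.

Lemma unitaryC U : unitary U -> adjmx U *m U = 1%:M.
Proof. exact: mulmx1C. Qed.

Lemma unitary_adj U : unitary U -> unitary (adjmx U).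
Proof. by move=> /unitaryC; rewrite /unitary adjmxK. Qed.

Lemma unitaryM U V : unitary U -> unitary V -> unitary (U *m V).
Proof.
move=> uU uV; rewrite /unitary adjmxM !mulmxA -[U *m V *m _]mulmxA uV mulmx1.
exact: uU.
Qed.

Lemma unitary_eig A U a : eig A U a -> unitary U. Proof. by case. Qed.

Lemma eig_mulmx A U a : eig A U a -> A *m U = U *m rdiag a.
Proof. by case=> uU ->; rewrite -mulmxA unitaryC// mulmx1. Qed.

Lemma eig_adj_mulmx A U a : eig A U a -> adjmx U *m A = rdiag a *m adjmx U.
Proof. by case=> uU ->; rewrite !mulmxA unitaryC// mul1mx. Qed.

Lemma eig_hermitian A U a : eig A U a -> is_hermitian A.
Proof.
by case=> _ ->; rewrite /is_hermitian !adjmxM adjmxK adjmx_rdiag mulmxA.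
Qed.

Lemma hermitian_eig A : is_hermitian A -> exists U a, eig A U a.
Proof.
move=> hA; have hA' : A = map_mx Num.conj A^T by rewrite -map_trmx -[LHS]hA.
have hs : A \is hermsymmx by apply/is_hermitianmxP; rewrite expr0 scale1r.
have /orthomx_spectralP := hermitian_normalmx hs.
have := spectral_unitarymx A => Pu; rewrite (invmx_unitary Pu).
have /mxOverP Dr := hermitian_spectral_diag_real hs.
set P := spectralmx A in Pu *; set D := spectral_diag A in Dr * => AE.
have PE : map_mx Num.conj P^T = adjmx P by rewrite -map_trmx.
exists (adjmx P), (fun i => complex.Re (D 0 i)).
have uP : unitary P by move/unitarymxP: Pu; rewrite PE.
split; first exact: unitary_adj.
rewrite adjmxK [LHS]AE PE; congr (_ *m diag_mx _ *m _).
by apply/rowP => i; rewrite mxE; apply/esym/RRe_real/Dr.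
Qed.

Lemma eigN A U a : eig A U a -> eig (- A) U (fun i => - a i).
Proof.
case=> uU ->; split=> //; rewrite -mulNmx -mulmxN; congr (_ *m _ *m _).
apply/matrixP => i j; rewrite !mxE; case: eqP => _; rewrite ?mulr1n ?mulr0n ?oppr0//.
by rewrite rmorphN.
Qed.

Lemma eigZ x A U a : eig A U a -> eig (rC x *: A) U (fun i => x * a i).
Proof.
case=> uU ->; split=> //; rewrite scalemxAl scalemxAr; congr (_ *m _ *m _).
by apply/matrixP => i j; rewrite !mxE rmorphM mulrnAr.
Qed.

Lemma eig_conj A U a V : unitary V -> eig A U a ->
  eig (V *m A *m adjmx V) (V *m U) a.
Proof.
move=> uV [uU ->]; split; first exact: unitaryM.
by rewrite adjmxM !mulmxA.
Qed.

Definition overlap U V i j := abs2 ((adjmx U *m V) i j).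

Lemma overlap_ge0 U V i j : 0 <= overlap U V i j. Proof. exact: abs2_ge0. Qed.

Lemma overlapC U V i j : overlap U V i j = overlap V U j i.
Proof. by rewrite /overlap -abs2_conj -adjmxE adjmxM adjmxK. Qed.

Lemma sum_abs2_row X i : rC (\sum_j abs2 (X i j)) = (X *m adjmx X) i i.
Proof.
by rewrite rmorph_sum mxE; apply: eq_bigr => j _; rewrite adjmxE -abs2E.
Qed.

Lemma sum_abs2_mulmx X V i : unitary V ->
  \sum_j abs2 ((X *m V) i j) = \sum_j abs2 (X i j).
Proof.
move=> uV; apply: (@complexI R); rewrite !sum_abs2_row adjmxM.
by rewrite !mulmxA -[X *m V *m _]mulmxA uV mulmx1.
Qed.

Lemma sum_overlap U V i : unitary U -> unitary V -> \sum_j overlap U V i j = 1.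
Proof.
move=> uU uV; rewrite sum_abs2_mulmx//.
apply: (@complexI R); rewrite sum_abs2_row adjmxK unitaryC//.
by rewrite mxE eqxx.
Qed.

Lemma sum_overlapC U V j : unitary U -> unitary V -> \sum_i overlap U V i j = 1.
Proof.
by move=> uU uV; under eq_bigr do rewrite overlapC; exact: sum_overlap.
Qed.

(** The form $\langle u_i, Y u_i\rangle$ on the columns of U, which need not be unitary:
    [sum_overlap_inv_le] evaluates it on other columns too. *)
Definition qform U Y i : R := complex.Re ((adjmx U *m Y *m U) i i).

Lemma qformD U X Y i : qform U (X + Y) i = qform U X i + qform U Y i.
Proof. by rewrite /qform mulmxDr mulmxDl mxE ReD. Qed.

Lemma qformN U Y i : qform U (- Y) i = - qform U Y i.
Proof. by rewrite /qform mulmxN mulNmx mxE; case: (_ i i). Qed.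

Lemma qformZ U x Y i : qform U (rC x *: Y) i = x * qform U Y i.
Proof. by rewrite /qform -scalemxAr -scalemxAl mxE Re_realM. Qed.

Lemma qform_rdiag X b i :
  complex.Re ((adjmx X *m rdiag b *m X) i i) = \sum_j b j * abs2 (X j i).
Proof.
rewrite mxE Re_sum; apply: eq_bigr => j _.
by rewrite mulmx_rdiag adjmxE mulrAC mulrC [_^* * _]mulrC -abs2E Re_realM.
Qed.

Lemma qform_eig U B V b i : eig B V b ->
  qform U B i = \sum_j b j * overlap U V i j.
Proof.
case=> uV ->; rewrite /qform !mulmxA.
rewrite -[in LHS]mulmxA.
have -> : adjmx U *m V = adjmx (adjmx V *m U) by rewrite adjmxM adjmxK.
rewrite qform_rdiag; apply: eq_bigr => j _.
by rewrite overlapC.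
Qed.

Lemma qform_self A U a i : eig A U a -> qform U A i = a i.
Proof.
move=> [uU ->]; rewrite /qform !mulmxA unitaryC// mul1mx -mulmxA unitaryC// mulmx1.
by rewrite mxE eqxx mulr1n mxE.
Qed.

(** The numbers $\langle u_i, v_j\rangle (b_j - a_i)$ form row i of the matrix of B - A between the
    bases V and U. Their square sum does not change when V is replaced by the eigenbasis Z of B - A,
    where the entries are $\langle u_i, z_k\rangle y_k$. *)
Lemma sum_overlap_sqr_diff A B U V Z a b y i :
  eig A U a -> eig B V b -> eig (B - A) Z y ->
  \sum_j overlap U V i j * (b j - a i) ^+ 2
    = \sum_k overlap U Z i k * y k ^+ 2.
Proof.
move=> eA eB eY; have uV := unitary_eig eB; have uZ := unitary_eig eY.
transitivity (\sum_j abs2 ((adjmx U *m (B - A) *m V) i j)).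
  apply: eq_bigr => j _.
  have -> : adjmx U *m (B - A) *m V =
      adjmx U *m V *m rdiag b - rdiag a *m (adjmx U *m V).
    by rewrite mulmxBr mulmxBl -mulmxA (eig_mulmx eB) (eig_adj_mulmx eA) !mulmxA.
  rewrite mxE [(- _ : matrix _ _ _) i j]mxE mulmx_rdiag mul_rdiag.
  by rewrite [_ * rC _]mulrC -mulrBl -rmorphB abs2M abs2_real mulrC.
rewrite sum_abs2_mulmx// -(@sum_abs2_mulmx _ Z)//.
apply: eq_bigr => k _; rewrite -mulmxA (eig_mulmx eY) mulmxA.
by rewrite mulmx_rdiag abs2M abs2_real.
Qed.

End SpectralWeights.

(** * The trace power Tr|A|^p *)

Section TracePower.
Variable R : realType.
Local Notation C := R[i].
Local Notation rC x := (real_complex R x).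
Variable m : nat.
Implicit Types (A B X Y U V Z : 'M[C]_m) (a b y : 'I_m -> R) (p q r : R).

(** Computing $U^\dagger A V$ in two ways shows that the overlap of $u_i$ and $v_j$ vanishes unless
    $a_i = b_j$; unit row and column sums then match the two spectra with multiplicity. *)
Lemma eig_sum_unique A U V a b (f : R -> R) : eig A U a -> eig A V b ->
  \sum_i f (a i) = \sum_i f (b i).
Proof.
move=> eA eB; have uU := unitary_eig eA; have uV := unitary_eig eB.
have E i j : overlap U V i j * f (a i) = overlap U V i j * f (b j).
  have : ((adjmx U *m V) *m rdiag b) i j = (rdiag a *m (adjmx U *m V)) i j.
    congr (_ _ i j).
    by rewrite -mulmxA -(eig_mulmx eB) mulmxA (eig_adj_mulmx eA) -mulmxA.
  rewrite mulmx_rdiag mul_rdiag /overlap mulrC => /eqP.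
  rewrite -subr_eq0 -mulrBl -rmorphB mulf_eq0 => /orP[/eqP|/eqP ->].
    by move=> /(@complexI R)/eqP; rewrite subr_eq0 => /eqP ->.
  by rewrite /abs2 /= expr0n addr0 !mul0r.
transitivity (\sum_i \sum_j overlap U V i j * f (a i)).
  by apply: eq_bigr => i _; rewrite -mulr_suml sum_overlap// mul1r.
rewrite exchange_big; apply: eq_bigr => j _.
by under eq_bigr do rewrite E; rewrite -mulr_suml sum_overlapC// mul1r.
Qed.

(* Tr|A|^p for Hermitian A, and the junk value 0 otherwise. *)
Definition trpow p A : R :=
  xget 0 [set t | exists U a, eig A U a /\ t = \sum_i `|a i| `^ p].

Lemma trpowE p A U a : eig A U a -> trpow p A = \sum_i `|a i| `^ p.
Proof.
move=> eA; rewrite /trpow; case: xgetP => [t _ [V [b [eB ->]]]|].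
  exact: (eig_sum_unique (fun t => `|t| `^ p) eB eA).
by move=> /(_ (\sum_i `|a i| `^ p)) []; exists U, a.
Qed.

Lemma trpow_ge0 p A : is_hermitian A -> 0 <= trpow p A.
Proof.
move=> /hermitian_eig [U [a eA]]; rewrite (trpowE _ eA).
by apply: sumr_ge0 => i _; exact: powR_ge0.
Qed.

Lemma trpowZ p x A : is_hermitian A -> trpow p (rC x *: A) = `|x| `^ p * trpow p A.
Proof.
move=> /hermitian_eig [U [a eA]]; rewrite (trpowE _ eA) (trpowE _ (eigZ x eA)).
by rewrite mulr_sumr; apply: eq_bigr => i _; rewrite normrM powRM.
Qed.

Lemma trpowN p A : is_hermitian A -> trpow p (- A) = trpow p A.
Proof.
move=> /hermitian_eig [U [a eA]]; rewrite (trpowE _ eA) (trpowE _ (eigN eA)).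
by apply: eq_bigr => i _; rewrite normrN.
Qed.

Lemma trpow0 p : 0 < p -> trpow p (0 : 'M[C]_m) = 0.
Proof.
move=> p0; rewrite -[X in trpow p X](scale0r 0) -(rmorph0 (real_complex R)).
by rewrite trpowZ ?normr0 ?powR0 ?mul0r ?gt_eqF//; exact: hermitian0.
Qed.

Lemma trpow_conj p A V : unitary V -> is_hermitian A ->
  trpow p (V *m A *m adjmx V) = trpow p A.
Proof.
by move=> uV /hermitian_eig [U [a eA]]; rewrite (trpowE _ eA) (trpowE _ (eig_conj uV eA)).
Qed.

Lemma rdiagM a b : rdiag a *m rdiag b = rdiag (fun i => a i * b i).
Proof.
apply/matrixP => i j; rewrite mul_rdiag !mxE; case: eqP => [->|_].
  by rewrite !mulr1n rmorphM.
by rewrite !mulr0n mulr0.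
Qed.

Lemma eig_gram A U V s : unitary U -> unitary V ->
  A = U *m rdiag s *m adjmx V -> eig (A *m adjmx A) U (fun i => s i ^+ 2).
Proof.
move=> uU uV ->; split=> //.
rewrite !adjmxM adjmxK adjmx_rdiag !mulmxA -[_ *m adjmx V *m V]mulmxA.
by rewrite unitaryC// mulmx1 -[_ *m rdiag s *m rdiag s]mulmxA rdiagM.
Qed.

(** The moduli of the eigenvalues form one list of singular values, with the signs moved into the
    right unitary factor. Any other list squares to the spectrum of A times its adjoint, so
    [eig_sum_unique] gives the same power sum. *)
Lemma schatten_trpow p A : is_hermitian A -> schatten p A = trpow p A `^ p^-1.
Proof.
move=> hA; have [U [a eA]] := hermitian_eig hA; have [uU AE] := eA.
(* The sign of 0 is taken to be 1, so that the diagonal matrix of signs is unitary. *)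
pose sg (x : R) : R := if x < 0 then -1 else 1.
have sgE (x : R) : `|x| * sg x = x.
  by rewrite /sg; case: ltrP => x0; rewrite ?(ltr0_norm x0) ?(ger0_norm x0); lra.
have sgsg (x : R) : sg x * sg x = 1 by rewrite /sg; case: ifP => _; lra.
have sv : singular_values A (fun i => `|a i|).
  split=> //; exists U, (U *m rdiag (sg \o a)); split=> //.
    rewrite /unitary adjmxM adjmx_rdiag mulmxA -[U *m _ *m rdiag _]mulmxA rdiagM.
    rewrite (_ : rdiag _ = 1%:M) ?mulmx1//.
    by apply/matrixP => i j; rewrite !mxE /= sgsg.
  rewrite adjmxM adjmx_rdiag mulmxA -[U *m _ *m rdiag _]mulmxA rdiagM.
  by rewrite AE; congr (_ *m _ *m _); congr diag_mx; apply/rowP => i; rewrite !mxE /= sgE.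
rewrite /schatten; set S := (X in inf X).
suff -> : S = [set trpow p A `^ p^-1]%classic by rewrite inf1.
apply/seteqP; split => [_ [s [s0 [V [W [uV uW AE']]]] <-]|_ ->]; last first.
  by exists (fun i => `|a i|) => //; rewrite (trpowE _ eA).
rewrite /= (trpowE _ eA); congr (_ `^ _).
have e1 := eig_gram uV uW AE'; have e2 := eig_gram uU uU AE.
have sqE (x : R) : (x ^+ 2) `^ (p / 2) = `|x| `^ p.
  rewrite -real_normK ?num_real// -powR_mulrn// -powRrM; congr (_ `^ _).
  by rewrite mulrC divfK.
transitivity (\sum_i (s i ^+ 2) `^ (p / 2)).
  by apply: eq_bigr => i _; rewrite sqE ger0_norm.
rewrite (eig_sum_unique (fun t => t `^ (p / 2)) e1 e2).
by apply: eq_bigr => i _; rewrite sqE.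
Qed.

Lemma schatten_leP p A (e : R) : 0 < p -> 0 <= e -> is_hermitian A ->
  (schatten p A <= e) = (trpow p A <= e `^ p).
Proof.
move=> p0 e0 hA; rewrite schatten_trpow//; have t0 := trpow_ge0 p hA.
apply/idP/idP => [/(ge0_ler_powR (ltW p0))|H].
  rewrite !nnegrE powR_ge0 -powRrM mulVf ?gt_eqF// powRr1//; exact.
have ip0 : 0 <= p^-1 by rewrite invr_ge0 ltW.
move: H => /(ge0_ler_powR ip0).
by rewrite !nnegrE t0 powR_ge0 -powRrM mulfV ?gt_eqF// powRr1//; exact.
Qed.

(** The derivative of [trpow p] in direction Y at $A = U\,\mathrm{diag}(a)\,U^\dagger$. The
    eigendecomposition is an argument, so that no canonical one has to be chosen. *)
Definition trpow_grad p U a Y : R := \sum_i p * spowR (p - 1) (a i) * qform U Y i.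

Lemma trpow_gradD p U a X Y :
  trpow_grad p U a (X + Y) = trpow_grad p U a X + trpow_grad p U a Y.
Proof. by rewrite -big_split; apply: eq_bigr => i _; rewrite qformD mulrDr. Qed.

Lemma trpow_gradZ p U a x Y :
  trpow_grad p U a (rC x *: Y) = x * trpow_grad p U a Y.
Proof. by rewrite mulr_sumr; apply: eq_bigr => i _; rewrite qformZ mulrCA. Qed.

Lemma trpow_grad0 p U a : trpow_grad p U a 0 = 0.
Proof. by rewrite -[0](scale0r 0) -(rmorph0 (real_complex R)) trpow_gradZ mul0r. Qed.

Lemma trpow_grad_sum p U a I (s : seq I) (P : pred I) (F : I -> 'M[C]_m) :
  trpow_grad p U a (\sum_(i <- s | P i) F i) =
  \sum_(i <- s | P i) trpow_grad p U a (F i).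
Proof. exact: (big_morph _ (trpow_gradD p U a) (trpow_grad0 p U a)). Qed.

Lemma trpow_bregman p A B U V a b : eig A U a -> eig B V b ->
  trpow p B - (trpow p A + trpow_grad p U a (B - A)) =
  \sum_i \sum_j overlap U V i j *
    (`|b j| `^ p - (`|a i| `^ p + p * spowR (p - 1) (a i) * (b j - a i))).
Proof.
move=> eA eB; have uU := unitary_eig eA; have uV := unitary_eig eB.
rewrite (trpowE _ eA) (trpowE _ eB).
under [in RHS]eq_bigr do under eq_bigr do rewrite mulrBr.
under [in RHS]eq_bigr do rewrite sumrB.
rewrite sumrB [in RHS]exchange_big /=; congr (_ - _).
  apply: eq_bigr => j _; by rewrite -mulr_suml sum_overlapC// mul1r.
rewrite -big_split; apply: eq_bigr => i _ /=.
under [in RHS]eq_bigr do rewrite mulrDr.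
rewrite big_split /= -mulr_suml sum_overlap// mul1r; congr (_ + _).
rewrite qformD qformN (qform_self _ eA) (qform_eig _ _ eB).
under [in RHS]eq_bigr do rewrite mulrCA.
rewrite -mulr_sumr; congr (_ * _).
under [in RHS]eq_bigr do rewrite mulrBr.
rewrite sumrB -mulr_suml sum_overlap// mul1r; congr (_ - _).
by apply: eq_bigr => j _; rewrite mulrC.
Qed.

Lemma trpow_ge_tangent p A B U a : 1 < p -> eig A U a -> is_hermitian B ->
  trpow p A + trpow_grad p U a (B - A) <= trpow p B.
Proof.
move=> p1 eA /hermitian_eig [V [b eB]]; rewrite -subr_ge0 (trpow_bregman _ eA eB).
apply: sumr_ge0 => i _; apply: sumr_ge0 => j _; apply: mulr_ge0.
  exact: overlap_ge0.
by rewrite subr_ge0 normr_powR_ge_tangent.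
Qed.

Lemma overlap_hoelder p U V a y (al et : R) : unitary U -> unitary V ->
  2 <= p -> 0 < al -> 0 < et ->
  \sum_i `|a i| `^ p <= al `^ p -> \sum_i `|y i| `^ p <= et `^ p ->
  \sum_i \sum_j overlap U V i j * (`|a i| `^ (p - 2) * y j ^+ 2)
    <= al `^ (p - 2) * et ^+ 2.
Proof.
move=> uU uV p2 al0 et0 Ha Hy; have p0 : 0 < p by lra.
set K := al `^ (p - 2) * et ^+ 2.
have K0 : 0 <= K by rewrite mulr_ge0 ?powR_ge0 ?sqr_ge0.
apply: (@le_trans _ _ (\sum_i \sum_j overlap U V i j * (K *
   ((p - 2) / p * (`|a i| `^ p / al `^ p) + 2 / p * (`|y j| `^ p / et `^ p))))).
  apply: ler_sum => i _; apply: ler_sum => j _; apply: ler_wpM2l.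
    exact: overlap_ge0.
  by rewrite -real_normK ?num_real//; exact: young_powR.
under eq_bigr do under eq_bigr do rewrite mulrCA.
under eq_bigr do rewrite -mulr_sumr.
rewrite -mulr_sumr -[leRHS]mulr1 ler_wpM2l//.
under eq_bigr do under eq_bigr do rewrite mulrDr.
under eq_bigr do rewrite big_split.
rewrite big_split /= [X in _ + X]exchange_big /=.
under eq_bigr do rewrite -mulr_suml sum_overlap// mul1r.
under [X in _ + X]eq_bigr do rewrite -mulr_suml sum_overlapC// mul1r.
rewrite -!mulr_sumr -!mulr_suml.
apply: (@le_trans _ _ ((p - 2) / p * 1 + 2 / p * 1)).
  apply: lerD; apply: ler_wpM2l.
  - by rewrite divr_ge0 ?(ltW p0)//; lra.
  - by rewrite ler_pdivrMr ?powR_gt0// mul1r.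
  - by rewrite divr_ge0 ?(ltW p0)//; lra.
  - by rewrite ler_pdivrMr ?powR_gt0// mul1r.
by rewrite !mulr1 -mulrDl subrK mulfV// gt_eqF.
Qed.

(** The scalar remainder bound has two halves, weighted by $|a_i|^{p-2}$ and $|b_j|^{p-2}$. In each,
    [sum_overlap_sqr_diff] replaces the squared differences by the spectrum of B - A, and
    [overlap_hoelder] finishes. *)
Lemma trpow_le_tangent p A B U a (al be et : R) : 2 <= p ->
  eig A U a -> is_hermitian B -> 0 < al -> 0 < be -> 0 < et ->
  trpow p A <= al `^ p -> trpow p B <= be `^ p -> trpow p (B - A) <= et `^ p ->
  trpow p B <= trpow p A + trpow_grad p U a (B - A)
    + p * (p - 1) * ((al `^ (p - 2) + be `^ (p - 2)) * et ^+ 2).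
Proof.
move=> p2 eA hB al0 be0 et0 HA HB HY.
have [V [b eB]] := hermitian_eig hB.
have uU := unitary_eig eA; have uV := unitary_eig eB.
have [Z [y eY]] := hermitian_eig (hermitianB hB (eig_hermitian eA)).
have eY' : eig (A - B) Z (fun i => - y i) by rewrite -opprB; exact: eigN.
have uZ := unitary_eig eY.
rewrite (trpowE _ eA) in HA; rewrite (trpowE _ eB) in HB; rewrite (trpowE _ eY) in HY.
rewrite -lerBlDl (trpow_bregman _ eA eB).
have K0 : 0 <= p * (p - 1) by rewrite mulr_ge0//; lra.
apply: (@le_trans _ _ (\sum_i \sum_j overlap U V i j * (p * (p - 1) *
    ((`|a i| `^ (p - 2) + `|b j| `^ (p - 2)) * (b j - a i) ^+ 2)))).
  apply: ler_sum => i _; apply: ler_sum => j _; apply: ler_wpM2l.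
    exact: overlap_ge0.
  by rewrite lerBlDl mulrA; exact: normr_powR_le_tangent.
under eq_bigr do under eq_bigr do rewrite mulrCA.
under eq_bigr do rewrite -mulr_sumr.
rewrite -mulr_sumr ler_wpM2l// mulrDl.
under eq_bigr do under eq_bigr do rewrite [X in _ * X]mulrDl mulrDr.
under eq_bigr do rewrite big_split.
rewrite big_split /= [X in _ + X]exchange_big /=; apply: lerD.
  apply: le_trans (overlap_hoelder uU uZ p2 al0 et0 HA HY).
  apply: ler_sum => i _; under eq_bigr do rewrite mulrCA.
  under [leRHS]eq_bigr do rewrite mulrCA.
  by rewrite -!mulr_sumr (sum_overlap_sqr_diff _ eA eB eY).
(* Now B is the base point and the difference to diagonalise is A - B, whose eigenvalues $-y_k$ have
   the same squares. *)
apply: le_trans (overlap_hoelder uV uZ p2 be0 et0 HB HY).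
apply: ler_sum => j _; under eq_bigr do rewrite mulrCA.
under [leRHS]eq_bigr do rewrite mulrCA.
rewrite -!mulr_sumr; under eq_bigr do rewrite overlapC -sqrrN opprB.
rewrite (sum_overlap_sqr_diff _ eB eA eY').
by under eq_bigr do rewrite sqrrN.
Qed.

(** Each [A j] lies above the tangent of the trace power at the mean, and the tangent terms cancel
    on averaging. *)
Lemma trpow_jensen p (I : finType) (w : I -> R) (A : I -> 'M[C]_m) : 1 < p ->
  (forall j, 0 <= w j) -> \sum_j w j = 1 -> (forall j, is_hermitian (A j)) ->
  trpow p (\sum_j rC (w j) *: A j) <= \sum_j w j * trpow p (A j).
Proof.
move=> p1 w0 w1 hA; set X := \sum_j _.
have hX : is_hermitian X by apply: hermitian_sum => j _; exact: hermitianZ.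
have [U [a eX]] := hermitian_eig hX.
have {1}-> : trpow p X = \sum_j w j * (trpow p X + trpow_grad p U a (A j - X)).
  under eq_bigr do rewrite mulrDr -trpow_gradZ.
  rewrite big_split -mulr_suml w1 mul1r /=.
  rewrite -trpow_grad_sum; under eq_bigr do rewrite scalerBr.
  rewrite sumrB -scaler_suml -rmorph_sum w1 rmorph1 scale1r subrr.
  by rewrite trpow_grad0 addr0.
by apply: ler_sum => j _; rewrite ler_wpM2l// trpow_ge_tangent.
Qed.

End TracePower.

(** * Clarkson's inequality and the triangle inequality *)

Section SchattenSmoothness.
Variable R : realType.
Local Notation C := R[i].
Local Notation rC x := (real_complex R x).
Variable m : nat.
Implicit Types (A B X Y U V Z : 'M[C]_m) (a b y : 'I_m -> R) (p q r : R).

Lemma normr_powR_half p (x : R) : `|x| `^ p = (x ^+ 2) `^ (p / 2).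
Proof.
rewrite -real_normK ?num_real// -powR_mulrn// -powRrM; congr (_ `^ _).
by rewrite mulrC divfK.
Qed.

Lemma eig_sqr X U a : eig X U a -> eig (X *m X) U (fun i => a i ^+ 2).
Proof.
move=> eX; have [uU XE] := eX; have := eig_gram uU uU XE.
by rewrite (eig_hermitian eX).
Qed.

Lemma qform_sqr_ge0 X W i : is_hermitian X -> 0 <= qform W (X *m X) i.
Proof.
move=> /hermitian_eig [U [a eX]]; rewrite (qform_eig _ _ (eig_sqr eX)).
by apply: sumr_ge0 => j _; rewrite mulr_ge0 ?sqr_ge0 ?overlap_ge0.
Qed.

(* With W = V diag(1/h) (V^* U) the column W u_i is H^+ u_i, and the claim is
   <u_i, H^+ u_i> >= |a_i <u_i, H^+ u_i>|^2, which follows from H >= X^2. *)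
Lemma sum_overlap_inv_le X Y U V a h i :
  eig X U a -> is_hermitian Y -> eig (X *m X + Y *m Y) V h ->
  a i ^+ 2 * \sum_j overlap U V i j * (h j)^-1 <= 1.
Proof.
move=> eX hY eH; have [uU XE] := eX; have [uV HE] := eH.
set z := \sum_j _; have z0 : 0 <= z.
  apply: sumr_ge0 => j _; rewrite mulr_ge0 ?overlap_ge0// invr_ge0.
  rewrite -(qform_self j eH) qformD addr_ge0 ?qform_sqr_ge0//.
  exact: eig_hermitian eX.
set K := adjmx U *m V; pose Om := rdiag (fun j => (h j)^-1) *m adjmx K.
pose W := V *m Om.
have zE : qform W (X *m X + Y *m Y) i = z.
  rewrite (qform_eig _ _ eH); apply: eq_bigr => j _.
  rewrite /overlap adjmxM -mulmxA unitaryC// mulmx1 adjmxE abs2_conj.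
  rewrite mul_rdiag abs2M abs2_real adjmxE abs2_conj.
  have [->|h0] := eqVneq (h j) 0; first by rewrite invr0 mul0r mulr0.
  by rewrite -/K; field.
have z1 : a i ^+ 2 * z ^+ 2 <= z.
  rewrite -[leRHS]zE qformD -[leLHS]addr0; apply: lerD; last exact: qform_sqr_ge0.
  rewrite (qform_eig _ _ (eig_sqr eX)) (bigD1 i)//= -[leLHS]addr0; apply: lerD.
    rewrite ler_wpM2l ?sqr_ge0//.
    rewrite /overlap (_ : (_ *m _) i i = rC z) ?abs2_real//.
    have -> : adjmx W *m U = adjmx Om *m adjmx K by rewrite !adjmxM !adjmxK -!mulmxA.
    rewrite -adjmxM adjmxE mxE rmorph_sum rmorph_sum /=.
    apply: eq_bigr => j _; rewrite mul_rdiag adjmxE !rmorphM /= conj_real conjCK.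
    by rewrite [in RHS]/overlap abs2E -/K; ring.
  by apply: sumr_ge0 => l _; rewrite mulr_ge0 ?sqr_ge0 ?overlap_ge0.
have [z00|zn0] := eqVneq z 0; first by rewrite z00 mulr0.
have zp : 0 < z by rewrite lt_def zn0.
by rewrite -(ler_pM2r zp) mul1r -mulrA -expr2.
Qed.

(** The left side is the trace of $H^{p/2-1}X^2$ for $H = X^2 + Y^2$. For each eigenvector $u_i$ of
    X, Jensen's inequality for the concave power 1 - p/2 reduces the claim to the bound on the mean
    of $1/h_j$ in [sum_overlap_inv_le]. *)
Lemma trpow_rotfeld p X Y V h : 0 < p < 2 ->
  is_hermitian X -> is_hermitian Y -> eig (X *m X + Y *m Y) V h ->
  \sum_j h j `^ (p / 2 - 1) * qform V (X *m X) j <= trpow p X.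
Proof.
move=> /andP[p0 p2] hX hY eH; have [U [a eX]] := hermitian_eig hX.
have uU := unitary_eig eX; have uV := unitary_eig eH.
have h0 j : 0 <= h j by rewrite -(qform_self j eH) qformD addr_ge0 ?qform_sqr_ge0.
rewrite (trpowE _ eX).
under eq_bigr do rewrite (qform_eig _ _ (eig_sqr eX)) mulr_sumr.
rewrite exchange_big; apply: ler_sum => i _ /=.
under eq_bigr do rewrite overlapC mulrCA [_ `^ _ * _]mulrC.
rewrite -mulr_sumr.
have [->|ai0] := eqVneq (a i) 0; first by rewrite expr0n mul0r powR_ge0.
have a2 : 0 < a i ^+ 2 by rewrite lt_def sqr_ge0 sqrf_eq0 ai0.
have zt := sum_overlap_inv_le i eX hY eH.
set z := (\sum_j overlap U V i j * (h j)^-1) in zt.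
pose s := 1 - p / 2; pose t := (a i ^+ 2)^-1.
have t0 : 0 < t by rewrite invr_gt0.
have {}zt : z <= t by rewrite -(ler_pM2l a2) mulfV ?gt_eqF.
have s01 : 0 < s <= 1 by rewrite /s; apply/andP; split; lra.
have H : \sum_j overlap U V i j * h j `^ (p / 2 - 1) <= t `^ s.
  apply: (@le_trans _ _ (\sum_j overlap U V i j *
     (t `^ s + s * t `^ (s - 1) * ((h j)^-1 - t)))).
    apply: ler_sum => j _; rewrite ler_wpM2l ?overlap_ge0//.
    (* This also holds at [h j = 0], where both sides are 0 by convention. *)
    have -> : h j `^ (p / 2 - 1) = (h j)^-1 `^ s.
      by rewrite -(powR_inv1 (h0 j)) -powRrM; congr (_ `^ _); rewrite /s; lra.
    by apply: powR_le_tangent => //; rewrite invr_ge0.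
  under eq_bigr do rewrite mulrDr mulrCA mulrBr.
  rewrite big_split -mulr_suml sum_overlap// mul1r -mulr_sumr sumrB -/z.
  rewrite -mulr_suml sum_overlap// mul1r gerDl.
  rewrite -oppr_ge0 -mulrN opprB mulr_ge0 ?subr_ge0//.
  by rewrite mulr_ge0 ?powR_ge0//; case/andP: s01 => /ltW.
apply: le_trans (ler_wpM2l (ltW a2) H) _.
rewrite normr_powR_half /t -(powR_inv1 (ltW a2)) -powRrM.
rewrite -{1}[a i ^+ 2](powRr1 (ltW a2)) -powRD; last by rewrite (gt_eqF a2) implybT.
by rewrite (_ : 1 + -1 * s = p / 2)// /s; lra.
Qed.

Lemma sum_overlap_concave p X V j (h : R) U a : 0 < p < 2 -> 0 < h ->
  unitary V -> eig X U a ->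
  \sum_i overlap U V i j * `|a i| `^ p <=
    h `^ (p / 2) + p / 2 * h `^ (p / 2 - 1) * (qform V (X *m X) j - h).
Proof.
move=> /andP[p0 p2] h0 uV eX; have uU := unitary_eig eX.
apply: (@le_trans _ _ (\sum_i overlap U V i j *
   (h `^ (p / 2) + p / 2 * h `^ (p / 2 - 1) * (a i ^+ 2 - h)))).
  apply: ler_sum => i _; rewrite ler_wpM2l ?overlap_ge0// normr_powR_half.
  by apply: powR_le_tangent; rewrite ?sqr_ge0//; apply/andP; split; lra.
under eq_bigr do rewrite mulrDr mulrCA mulrBr.
rewrite big_split -mulr_suml sum_overlapC// mul1r -mulr_sumr sumrB.
rewrite -mulr_suml sum_overlapC// mul1r (qform_eig _ _ (eig_sqr eX)).
by under eq_bigr do rewrite overlapC mulrC.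
Qed.

Lemma add_tangent_bound (q1 q2 h H k t1 t2 : R) : q1 + q2 = h + h ->
  t1 <= H + k * (q1 - h) -> t2 <= H + k * (q2 - h) -> t1 + t2 <= 2 * H.
Proof.
move=> qh h1 h2; have -> : 2 * H = H + k * (q1 - h) + (H + k * (q2 - h)); last exact: lerD.
have -> : q1 = h + h - q2 by rewrite -qh addrK.
by ring.
Qed.

(** Since $(X+Y)^2 + (X-Y)^2 = 2H$ with $H = X^2+Y^2$, concavity of $z^{p/2}$ in an eigenbasis of H
    bounds the left side by $2\,\mathrm{Tr}\,H^{p/2}$, which [trpow_rotfeld], applied to X and to Y,
    bounds by the right side. *)
Lemma trpow_clarkson p X Y : 0 < p < 2 -> is_hermitian X -> is_hermitian Y ->
  trpow p (X + Y) + trpow p (X - Y) <= 2 * (trpow p X + trpow p Y).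
Proof.
move=> p02 hX hY; have /andP[p0 p2] := p02.
have sq Z : is_hermitian Z -> is_hermitian (Z *m Z).
  by move=> hZ; rewrite /is_hermitian adjmxM hZ.
have [V [h eH]] := hermitian_eig (hermitianD (sq _ hX) (sq _ hY)).
have uV := unitary_eig eH.
have h0 j : 0 <= h j by rewrite -(qform_self j eH) qformD addr_ge0 ?qform_sqr_ge0.
apply: (@le_trans _ _ (2 * \sum_j h j `^ (p / 2))); last first.
  rewrite ler_wpM2l//.
  have -> : \sum_j h j `^ (p / 2) = \sum_j (h j `^ (p / 2 - 1) * qform V (X *m X) j
      + h j `^ (p / 2 - 1) * qform V (Y *m Y) j).
    apply: eq_bigr => j _; rewrite -mulrDr -qformD (qform_self j eH) [RHS]mulrC mulr_powRB1//.
    by rewrite divr_gt0.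
  rewrite big_split; apply: lerD; first exact: trpow_rotfeld eH.
  by apply: trpow_rotfeld hX _ => //; rewrite addrC; exact: eH.
have [S [s eS]] := hermitian_eig (hermitianD hX hY).
have [D [d eD]] := hermitian_eig (hermitianB hX hY).
have spread W Z b : eig Z W b ->
    trpow p Z = \sum_j \sum_i overlap W V i j * `|b i| `^ p.
  move=> eZ; rewrite (trpowE _ eZ) exchange_big; apply: eq_bigr => i _.
  by rewrite -mulr_suml sum_overlap ?mul1r//; exact: unitary_eig eZ.
rewrite (spread _ _ _ eS) (spread _ _ _ eD) -big_split mulr_sumr.
apply: ler_sum => j _ /=.
have hjE : qform V ((X + Y) *m (X + Y)) j + qform V ((X - Y) *m (X - Y)) j = h j + h j.
  have E : (X + Y) *m (X + Y) + (X - Y) *m (X - Y)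
      = (X *m X + Y *m Y) + (X *m X + Y *m Y).
    rewrite !mulmxDl !mulmxDr !mulNmx !mulmxN opprK.
    move: (X *m X) (X *m Y) (Y *m X) (Y *m Y) => a b c e.
    by apply/matrixP => k l; rewrite !mxE; ring.
  by rewrite -qformD E [LHS]qformD (qform_self j eH).
have hS := qform_sqr_ge0 V j (hermitianD hX hY).
have hD := qform_sqr_ge0 V j (hermitianB hX hY).
have [hj0|hjn0] := eqVneq (h j) 0; last first.
  have hj : 0 < h j by rewrite lt_def hjn0 h0.
  apply: add_tangent_bound hjE _ _.
    exact: sum_overlap_concave p02 hj uV eS.
  exact: sum_overlap_concave p02 hj uV eD.
have hh0 : h j + h j = 0 by rewrite hj0 addr0.
have /eqP := etrans hjE hh0; rewrite (paddr_eq0 hS hD) => /andP[/eqP qS /eqP qD].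
have z W Z b : eig Z W b -> qform V (Z *m Z) j = 0 ->
    \sum_i overlap W V i j * `|b i| `^ p = 0.
  move=> eZ; rewrite (qform_eig _ _ (eig_sqr eZ)) => /eqP.
  rewrite psumr_eq0 => [/allP H|i _]; last by rewrite mulr_ge0 ?sqr_ge0 ?overlap_ge0.
  apply: big1 => i _; have := H i (mem_index_enum _).
  rewrite mulf_eq0 sqrf_eq0 overlapC => /orP[/eqP ->|/eqP ->].
    by rewrite normr0 powR0 ?mulr0// gt_eqF.
  by rewrite mul0r.
have zS := z _ _ _ eS qS; have zD := z _ _ _ eD qD.
by rewrite zS zD addr0 mulr_ge0 ?powR_ge0.
Qed.

(** Clarkson bounds the sum of the values at X + Y and X - Y from above; convexity bounds the value
    at X - Y from below, with the gradient term negated. The claim is the difference. *)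
Lemma trpow_le_clarkson p X Y U a : 1 < p < 2 -> eig X U a -> is_hermitian Y ->
  trpow p (X + Y) <= trpow p X + trpow_grad p U a Y + 2 * trpow p Y.
Proof.
move=> /andP[p1 p2] eX hY; have hX := eig_hermitian eX.
have p02 : 0 < p < 2 by apply/andP; split; lra.
have := trpow_clarkson p02 hX hY.
have := trpow_ge_tangent p1 eX (hermitianB hX hY).
have -> : X - Y - X = rC (-1) *: Y by rewrite rmorphN1 scaleN1r addrAC subrr sub0r.
rewrite trpow_gradZ; lra.
Qed.

(** X + Y is the mean of X and Y, both rescaled to radius x + y, with weights x/(x+y) and
    y/(x+y). *)
Lemma trpow_triangle p X Y (x y : R) : 1 < p -> 0 < x -> 0 < y ->
  is_hermitian X -> is_hermitian Y ->
  trpow p X <= x `^ p -> trpow p Y <= y `^ p -> trpow p (X + Y) <= (x + y) `^ p.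
Proof.
move=> p1 x0 y0 hX hY HX HY; have s0 : 0 < x + y by rewrite addr_gt0.
pose w (i : 'I_2) := if i == ord0 then x / (x + y) else y / (x + y).
pose A (i : 'I_2) := if i == ord0 then rC ((x + y) / x) *: X else rC ((x + y) / y) *: Y.
have w0 i : 0 <= w i by rewrite /w; case: ifP => _; rewrite divr_ge0// ltW.
have w1 : \sum_i w i = 1.
  by rewrite big_ord_recl big_ord1 /w /= -mulrDl mulfV// gt_eqF.
have hA i : is_hermitian (A i) by rewrite /A; case: ifP => _; exact: hermitianZ.
have := trpow_jensen p1 w0 w1 hA.
rewrite !big_ord_recl !big_ord0 /w /A /= !addr0 !scalerA -!rmorphM /=.
have -> : x / (x + y) * ((x + y) / x) = 1 by field; rewrite !gt_eqF.
have -> : y / (x + y) * ((x + y) / y) = 1 by field; rewrite !gt_eqF.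
rewrite rmorph1 !scale1r => /le_trans; apply.
have E (z : R) Z : 0 < z -> is_hermitian Z -> trpow p Z <= z `^ p ->
    trpow p (rC ((x + y) / z) *: Z) <= (x + y) `^ p.
  move=> z0 hZ HZ; rewrite trpowZ// ger0_norm ?divr_ge0 ?(ltW z0) ?(ltW s0)//.
  have -> : (x + y) `^ p = ((x + y) / z) `^ p * z `^ p.
    by rewrite -powRM ?divr_ge0 ?(ltW z0) ?(ltW s0)// mulfVK// gt_eqF.
  by rewrite ler_wpM2l ?powR_ge0.
rewrite -[leRHS]mul1r -w1 big_ord_recl big_ord1 /w /= [leRHS]mulrDl.
by apply: lerD; apply: ler_wpM2l; rewrite ?E// divr_ge0// ltW.
Qed.

End SchattenSmoothness.

(** * Greedy approximation of convex combinations *)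

Section Greedy.
Variable R : realType.
Local Notation C := R[i].
Local Notation rC x := (real_complex R x).

Lemma expR1_ge2 : 2 <= expR 1 :> R.
Proof. by have := @expR_ge1Dx R 1; lra. Qed.

Lemma expR1_sqr : 4 <= expR 1 ^+ 2 :> R /\ 2 * expR 1 <= expR 1 ^+ 2 :> R.
Proof.
have e2 := expR1_ge2; have e0 : 0 <= expR 1 :> R := expR_ge0 1.
have := ler_wpM2r e0 e2; rewrite expr2; split; lra.
Qed.

Lemma powR_leI (p x y : R) : 0 < p -> 0 <= x -> 0 <= y -> x `^ p <= y `^ p -> x <= y.
Proof.
move=> p0 x0 y0; rewrite leNgt => h; rewrite leNgt; apply: contra h => yx.
by rewrite gt0_ltr_powR// nnegrE.
Qed.

(** This converts growth of p-th powers into growth of squares. A step of 2 from $a \ge 2(p-1)$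
    multiplies a by at most $1 + 1/(p-1) \le e^{1/(p-1)}$, whence $b^{p-2} \le e\,a^{p-2}$. *)
Lemma greedy_scalar (p a b : R) : 2 <= p -> 2 * (p - 1) <= a -> 0 < b -> b <= a + 2 ->
  b `^ p <= a `^ p + p * (p - 1) * ((a `^ (p - 2) + b `^ (p - 2)) * 2 ^+ 2) ->
  b ^+ 2 <= a ^+ 2 + 2 * expR 1 ^+ 4 * (p - 1).
Proof.
move=> p2 ap b0 ba H.
have a0 : 0 < a by lra.
set e := expR 1 : R; have e2 : 2 <= e := expR1_ge2.
have p10 : 0 < p - 1 by lra.
have bp : b `^ (p - 2) <= e * a `^ (p - 2).
  have ba' : b <= expR (p - 1)^-1 * a.
    apply: (le_trans ba); apply: (@le_trans _ _ ((1 + (p - 1)^-1) * a)).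
      rewrite mulrDl mul1r lerD2l -(ler_pM2l p10) mulrA mulfV ?gt_eqF// mul1r.
      by rewrite mulrC.
    by rewrite ler_wpM2r ?(ltW a0)// expR_ge1Dx.
  have p20 : 0 <= p - 2 by lra.
  have := ge0_ler_powR p20 _ _ ba'.
  rewrite !nnegrE (ltW b0) mulr_ge0 ?expR_ge0 ?(ltW a0)// => /(_ isT isT) /le_trans; apply.
  rewrite powRM ?expR_ge0 ?(ltW a0)// ler_wpM2r ?powR_ge0// -expRM ler_expR.
  by rewrite mulrC ler_pdivrMr// mul1r; lra.
(* With this K the tangent to $z^{p/2}$ at $a^2$ gains exactly $4p(p-1)(1+e)a^{p-2}$, the increment
   left once $b^{p-2}$ has been bounded. *)
set K := 8 * (p - 1) * (1 + e).
have sqE (x r : R) : 0 < x -> (x ^+ 2) `^ r = x `^ (2 * r).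
  by move=> x0; rewrite -powR_mulrn ?(ltW x0)// -powRrM.
have b2 : b ^+ 2 <= a ^+ 2 + K.
  have K0 : 0 <= K by rewrite /K !mulr_ge0//; lra.
  have ph : 0 < p / 2 by lra.
  apply: (powR_leI ph); rewrite ?addr_ge0 ?sqr_ge0//.
  have ph1 : 1 <= p / 2 by lra.
  have aK0 : 0 <= a ^+ 2 + K by rewrite addr_ge0 ?sqr_ge0.
  apply: le_trans (powR_ge_tangent ph1 (sqr_ge0 a) aK0).
  rewrite !sqE//.
  have -> : 2 * (p / 2) = p by field.
  have -> : 2 * (p / 2 - 1) = p - 2 by field.
  apply: (le_trans H); rewrite lerD2l.
  have pp : 0 <= p * (p - 1) * 4 by rewrite !mulr_ge0//; lra.
  have := ler_wpM2l pp bp; set x := a `^ _; set y := b `^ _; rewrite /K; lra.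
apply: (le_trans b2); rewrite lerD2l /K.
have -> : 2 * e ^+ 4 * (p - 1) = (p - 1) * (2 * e ^+ 4) by ring.
have -> : 8 * (p - 1) * (1 + e) = (p - 1) * (8 * (1 + e)) by ring.
rewrite ler_wpM2l ?(ltW p10)//.
have [] := expR1_sqr; rewrite -/e => e22 ee.
have -> : e ^+ 4 = e ^+ 2 * e ^+ 2 by ring.
have := ler_wpM2r (sqr_ge0 e) e22; lra.
Qed.

Variable m : nat.
Implicit Types (A B X Y U V Z : 'M[C]_m) (a b y : 'I_m -> R) (p q r : R).

Variables (p : R) (k : nat) (w : 'I_k -> R) (P : 'I_k -> 'M[C]_m).
Hypotheses (p1 : 1 < p) (w0 : forall j, 0 <= w j) (w1 : \sum_j w j = 1).
Hypotheses (hP : forall j, is_hermitian (P j)) (nP : forall j, trpow p (P j) <= 1).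
Let X := \sum_j rC (w j) *: P j.

Lemma exists_le_mean (L : 'I_k -> R) : \sum_j w j * L j = 0 -> exists j, L j <= 0.
Proof.
move=> H; apply/not_existsP => nL.
have Lp j : 0 < L j by rewrite ltNge; apply/negP/nL.
have wL j : w j = 0.
  have /eqP := H; rewrite psumr_eq0 => [/allP/(_ j (mem_index_enum _))|i _].
    by rewrite mulf_eq0 (gt_eqF (Lp j)) orbF => /eqP.
  by rewrite mulr_ge0// ltW.
by have := w1; rewrite big1 => [/eqP|j _]; rewrite ?wL// eq_sym oner_eq0.
Qed.

Lemma hermitian_mean : is_hermitian X.
Proof. by apply: hermitian_sum => j _; exact: hermitianZ. Qed.

Lemma trpow_mean : trpow p X <= 1.
Proof.
apply: le_trans (trpow_jensen p1 w0 w1 hP) _; rewrite -[leRHS]w1.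
by apply: ler_sum => j _; rewrite ler_piMr.
Qed.

Lemma hermitian_dev j : is_hermitian (P j - X).
Proof. exact/hermitianB/hermitian_mean. Qed.

Lemma trpow_dev j : trpow p (P j - X) <= 2 `^ p.
Proof.
have -> : 2 = 1 + 1 :> R by lra.
apply: trpow_triangle => //; rewrite ?powR1//; first exact: hermitianN hermitian_mean.
by rewrite trpowN ?trpow_mean//; exact: hermitian_mean.
Qed.

Lemma grad_dev U a : exists j, trpow_grad p U a (P j - X) <= 0.
Proof.
apply: exists_le_mean.
under eq_bigr do rewrite -trpow_gradZ scalerBr.
rewrite -trpow_grad_sum sumrB -scaler_suml -rmorph_sum w1 rmorph1 scale1r subrr.
exact: trpow_grad0.
Qed.

Lemma hermitian_devs (f : nat -> 'I_k) K : is_hermitian (\sum_(t < K) (P (f t) - X)).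
Proof. by apply: hermitian_sum => t _; exact: hermitian_dev. Qed.

Lemma extend_choice (f : nat -> 'I_k) K j :
  exists f' : nat -> 'I_k, \sum_(t < K.+1) (P (f' t) - X) =
    \sum_(t < K) (P (f t) - X) + (P j - X).
Proof.
exists (fun t => if t == K then j else f t); rewrite big_ord_recr /= eqxx.
by congr (_ + _); apply: eq_bigr => t _; rewrite ltn_eqF.
Qed.

Lemma greedy_lt2 K : p < 2 -> exists f : nat -> 'I_k,
  trpow p (\sum_(t < K) (P (f t) - X)) <= 2 * 2 `^ p * K%:R.
Proof.
move=> p2; have p0 : 0 < p := lt_trans ltr01 p1.
elim: K => [|K [f IH]].
  (* The start needs some element of ['I_k]; [grad_dev] at arbitrary arguments supplies one. *)
  have [j _] := grad_dev 0 (fun=> 0).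
  by exists (fun=> j); rewrite big_ord0 trpow0// !mulr_ge0 ?powR_ge0 ?ler0n.
have [U [a eS]] := hermitian_eig (hermitian_devs f K).
have [j Lj] := grad_dev U a; have [f' Ef'] := extend_choice f K j.
exists f'; rewrite Ef'.
have p12 : 1 < p < 2 by apply/andP.
have := trpow_le_clarkson p12 eS (hermitian_dev j).
have := trpow_dev j; rewrite -[K.+1%:R]natr1 mulrDr mulr1; lra.
Qed.

(** Two bounds run through the induction: the linear one, from the triangle inequality, covers the
    early steps, and the square-root one takes over once the norm is large enough for
    [greedy_scalar]. *)
Lemma greedy_ge2 K : 2 <= p -> exists f : nat -> 'I_k,
  trpow p (\sum_(t < K) (P (f t) - X)) <= (2 * K%:R) `^ p /\
  trpow p (\sum_(t < K) (P (f t) - X)) <=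
    (2 * expR 1 ^+ 4 * (p - 1) * K%:R) `^ (p / 2).
Proof.
move=> p2; set c := 2 * _ * _; have p0 : 0 < p by lra.
have e2 := expR1_ge2.
have c32 : 32 * (p - 1) <= c.
  rewrite /c ler_wpM2r//; first by lra.
  have [e22 _] := expR1_sqr.
  have -> : expR 1 ^+ 4 = expR 1 ^+ 2 * expR 1 ^+ 2 :> R by ring.
  have := ler_wpM2r (sqr_ge0 (expR 1)) e22; lra.
have c0 : 0 < c by lra.
have half (x : R) : 0 <= x -> x `^ p = (x ^+ 2) `^ (p / 2).
  by move=> x0; rewrite -normr_powR_half ger0_norm.
have ph : 0 <= p / 2 by lra.
have q0 : 0 < 2 * (p - 1) by lra.
elim: K => [|K [f [IH1 IH2]]].
  have [j _] := grad_dev 0 (fun=> 0).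
  by exists (fun=> j); rewrite big_ord0 trpow0// !powR_ge0.
have S0 : K = 0%N -> \sum_(t < K) (P (f t) - X) = 0 by move=> ->; rewrite big_ord0.
set S := \sum_(t < K) _ in IH1 IH2 S0; have hS : is_hermitian S := hermitian_devs f K.
have [U [a eS]] := hermitian_eig hS.
have [j Lj] := grad_dev U a; have [f' Ef'] := extend_choice f K j.
exists f'; rewrite Ef' -/S; set D := P j - X in Lj *; have hD : is_hermitian D := hermitian_dev j.
have hSD := hermitianD hS hD.
have nD : trpow p D <= 2 `^ p := trpow_dev j.
have T1 : trpow p (S + D) <= (2 * K.+1%:R) `^ p.
  case: (posnP K) => [K0|K0].
    by rewrite S0// add0r K0 mulr1.
  rewrite -[K.+1%:R]natr1 mulrDr mulr1; apply: trpow_triangle => //.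
  by rewrite mulr_gt0// ltr0n.
split=> //; set k1 := K.+1%:R : R; have k10 : 1 <= k1 by rewrite ler1n.
have k00 : 0 <= k1 := le_trans ler01 k10.
have [small|large] := leP (4 * k1) c.
  apply: (le_trans T1); rewrite -/k1 half ?mulr_ge0//.
  have H : (2 * k1) ^+ 2 <= c * k1 by have := ler_wpM2r k00 small; lra.
  by rewrite ge0_ler_powR// ?nnegrE ?sqr_ge0// mulr_ge0// ltW.
(* A sum of norm at most 2(p-1) grows to at most 2p, and $4p^2 \le c k_1$ because $c \ge 16p$ and
   $4k_1 > c$. *)
have [tS|tS] := leP (trpow p S) ((2 * (p - 1)) `^ p).
  have := trpow_triangle p1 q0 (ltr0n R 2) hS hD tS nD.
  move/le_trans; apply; rewrite half; last by lra.
  have p160 : 0 <= 16 * p by lra.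
  have cp : 16 * p <= c by lra.
  have H : (2 * (p - 1) + 2) ^+ 2 <= c * k1.
    have := ler_pM p160 p160 cp cp.
    have := ler_wpM2l (ltW c0) (ltW large); have := sqr_ge0 p; lra.
  by rewrite ge0_ler_powR// ?nnegrE ?sqr_ge0// mulr_ge0// ltW.
set al := trpow p S `^ p^-1; set be := trpow p (S + D) `^ p^-1.
have ro Z : is_hermitian Z -> (trpow p Z `^ p^-1) `^ p = trpow p Z.
  by move=> hZ; rewrite -powRrM mulVf ?gt_eqF// powRr1// trpow_ge0.
have alE : al `^ p = trpow p S := ro _ hS; have beE : be `^ p = trpow p (S + D) := ro _ hSD.
have al2 : 2 * (p - 1) <= al.
  by apply: (powR_leI p0); rewrite ?powR_ge0 ?alE ?(ltW tS) ?(ltW q0).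
have alK : al ^+ 2 <= c * K%:R.
  have ph0 : 0 < p / 2 by rewrite divr_gt0.
  have cK : 0 <= c * K%:R by rewrite mulr_ge0 ?ler0n// ltW.
  apply: (powR_leI ph0); rewrite ?sqr_ge0//.
  by rewrite -half ?powR_ge0// alE.
rewrite -beE half ?powR_ge0//.
apply: ge0_ler_powR => //; rewrite ?nnegrE ?sqr_ge0//.
  by rewrite mulr_ge0// ltW.
have -> : c * k1 = c * K%:R + c by rewrite /k1 -[K.+1%:R]natr1 mulrDr mulr1.
have [bea|abe] := leP be al.
  apply: (@le_trans _ _ (al ^+ 2)); first by rewrite ler_sqr ?nnegrE ?powR_ge0.
  by apply: le_trans alK _; rewrite lerDl ltW.
apply: (@le_trans _ _ (al ^+ 2 + c)); last by rewrite lerD2r.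
have al0 : 0 < al := lt_le_trans q0 al2.
have be0 : 0 < be := lt_trans al0 abe.
apply: (greedy_scalar p2 al2 be0).
  apply: (powR_leI p0); rewrite ?(ltW be0) ?addr_ge0 ?(ltW al0)// beE.
  by apply: trpow_triangle => //; rewrite alE.
have SDS : S + D - S = D by rewrite (addrC S) addrK.
have HA : trpow p S <= al `^ p by rewrite alE.
have HB : trpow p (S + D) <= be `^ p by rewrite beE.
have HD : trpow p (S + D - S) <= 2 `^ p by rewrite SDS.
have := trpow_le_tangent p2 eS hSD al0 be0 (ltr0n R 2) HA HB HD.
rewrite SDS -alE -beE => /le_trans; apply.
by rewrite lerD2r gerDl.
Qed.

End Greedy.

(** * Tensor products of psd matrices and the gauge *)

Section Psd.
Variable R : realType.
Local Notation C := R[i].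
Local Notation rC x := (real_complex R x).
Variable m : nat.
Implicit Types (A : 'M[C]_m) (x v : 'cV[C]_m).

Lemma psd_formE A x : ((map_mx Num.conj x)^T *m A *m x) 0 0 =
  \sum_k \sum_l Num.conj (x k 0) * A k l * x l 0.
Proof.
rewrite mxE exchange_big; apply: eq_bigr => l _ /=; rewrite mxE mulr_suml.
by apply: eq_bigr => k _; rewrite !mxE.
Qed.

Lemma psd_rank1 v : is_psd (\matrix_(k, l) (v k 0 * Num.conj (v l 0))).
Proof.
move=> x; rewrite psd_formE; set y := \sum_l Num.conj (v l 0) * x l 0.
suff -> : \sum_k \sum_l Num.conj (x k 0) *
    (\matrix_(k, l) (v k 0 * Num.conj (v l 0))) k l * x l 0 = y * Num.conj y.
  exact: mul_conjC_ge0.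
rewrite mulrC rmorph_sum mulr_suml; apply: eq_bigr => k _ /=.
by rewrite mulr_sumr; apply: eq_bigr => l _; rewrite mxE rmorphM /= conjCK; ring.
Qed.

Lemma psdZ t A : 0 <= t -> is_psd A -> is_psd (rC t *: A).
Proof.
by move=> t0 pA x; rewrite -scalemxAr -scalemxAl mxE mulr_ge0// ler0c.
Qed.

Lemma psd0 : is_psd (0 : 'M[C]_m).
Proof. by move=> x; rewrite mulmx0 mul0mx mxE. Qed.

(** Every value $x^\dagger A x$ is nonnegative, hence real. On the vectors $e_i$, $e_j$, $e_i + e_j$
    and $e_i + \mathrm{i}\,e_j$ this gives linear equations that force $A_{ij} =
    \overline{A_{ji}}$. *)
Lemma psd_hermitian A : is_psd A -> is_hermitian A.
Proof.
move=> pA; apply/matrixP => i j; rewrite adjmxE.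
have re (z w : C) : Num.conj z * z * A i i + Num.conj z * w * A i j +
    (Num.conj w * z * A j i + Num.conj w * w * A j j) \is Num.real.
  pose x : 'cV[C]_m := z *: delta_mx i 0 + w *: delta_mx j 0.
  suff <- : ((map_mx Num.conj x)^T *m A *m x) 0 0 = Num.conj z * z * A i i +
      Num.conj z * w * A i j + (Num.conj w * z * A j i + Num.conj w * w * A j j).
    exact/ger0_real/pA.
  rewrite psd_formE.
  have xE k : x k 0 = z * (k == i)%:R + w * (k == j)%:R.
    by rewrite !mxE !eqxx !andbT.
  have pick (F : 'I_m -> C) k0 (t : C) :
      \sum_k t * (k == k0)%:R * F k = t * F k0.
    rewrite (bigD1 k0)//= eqxx mulr1 big1 ?addr0// => k /negPf ->.
    by rewrite mulr0 mul0r.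
  have sumx (F : 'I_m -> C) : \sum_l F l * x l 0 = z * F i + w * F j.
    under eq_bigr do rewrite mulrC xE mulrDl.
    by rewrite big_split /= !pick.
  under eq_bigr do rewrite sumx.
  have -> : \sum_k (z * (Num.conj (x k 0) * A k i) + w * (Num.conj (x k 0) * A k j))
     = \sum_k (Num.conj z * (k == i)%:R * (z * A k i + w * A k j)
             + Num.conj w * (k == j)%:R * (z * A k i + w * A k j)).
    apply: eq_bigr => k _; rewrite xE rmorphD !rmorphM !rmorph_nat /=; ring.
  by rewrite big_split /= !pick; ring.
have reIm (z : C) : z \is Num.real -> complex.Im z = 0.
  by case: z => u v; rewrite complex_real => /eqP.
have := reIm _ (re (Complex 1 0) (Complex 0 0)).
have := reIm _ (re (Complex 0 0) (Complex 1 0)).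
have := reIm _ (re (Complex 1 0) (Complex 1 0)).
have := reIm _ (re (Complex 1 0) (Complex 0 1)).
case: (A i i) (A i j) (A j i) (A j j) => [a a'] [b b'] [c c'] [e e'] /=.
by move=> h1 h2 h3 h4; congr Complex; lra.
Qed.

End Psd.

(** * Polarization into psd tensors and finiteness of the gauge *)

Section Tensors.
Variable R : realType.
Local Notation C := R[i].
Local Notation rC x := (real_complex R x).
Variables (n : nat) (d : 'I_n.+1 -> nat).
Local Notation MX := 'M[C]_#|mindex n d|.
Implicit Types (rho : forall i : 'I_n.+1, 'M[C]_(d i)) (M : MX).

Lemma tens_scale (z : 'I_n.+1 -> C) rho :
  tens (fun i => z i *: rho i) = (\prod_i z i) *: tens rho.
Proof.
apply/matrixP => a b; rewrite !mxE -big_split; apply: eq_bigr => i _.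
by rewrite mxE.
Qed.

Lemma tens_hermitian rho : (forall i, is_hermitian (rho i)) -> is_hermitian (tens rho).
Proof.
move=> h; apply/matrixP => a b; rewrite adjmxE !mxE rmorph_prod.
by apply: eq_bigr => i _; rewrite -[in RHS]h adjmxE.
Qed.

Lemma Pp_hermitian p M : Pp p M -> is_hermitian M.
Proof.
move=> [b [rho [pr _ ->]]]; rewrite -signr_odd; case: (odd b).
  by rewrite scaleN1r; apply/hermitianN/tens_hermitian => i; exact: psd_hermitian.
by rewrite scale1r; apply: tens_hermitian => i; exact: psd_hermitian.
Qed.

Lemma Pp_trpow p M : 0 < p -> Pp p M -> trpow p M <= 1.
Proof.
move=> p0 [b [rho [pr s1 ->]]].
have h : is_hermitian (tens rho) by apply: tens_hermitian => i; exact: psd_hermitian.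
have t1 : trpow p (tens rho) <= 1 by move: s1; rewrite schatten_leP// powR1.
by rewrite -signr_odd; case: (odd b); rewrite ?scaleN1r ?trpowN// scale1r.
Qed.

Lemma prod_mindex_eq (a r : 'I_#|mindex n d|) :
  \prod_i ((enum_val a : mindex n d) i == (enum_val r : mindex n d) i)%:R
    = (a == r)%:R :> C.
Proof.
have [->|ar] := eqVneq a r; first by apply: big1 => i _; rewrite eqxx.
have [i ni] : exists i, (enum_val a : mindex n d) i != (enum_val r : mindex n d) i.
  apply/existsP; apply: contraNT ar; rewrite negb_exists => /forallP H.
  by apply/eqP/enum_val_inj/ffunP => i; apply/eqP; move: (H i); rewrite negbK.
by rewrite (bigD1 i)//= (negPf ni) mul0r.
Qed.

(** The vectors $v_j = e_r + \mathrm{i}^j e_s$ of the polarization identity: $\frac14\sum_j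
    \mathrm{i}^j v_j v_j^\dagger$ is the matrix unit $E_{rs}$. *)
Definition polar_vec k (r s : 'I_k) (j : 'I_4) : 'cV[C]_k :=
  delta_mx r 0 + 'i ^+ j *: delta_mx s 0.

Lemma sum_polarization (x y z w : C) :
  \sum_(j < 4) 'i ^+ j / 4 * ((x + 'i ^+ j * z) * (y + (- 'i) ^+ j * w)) = x * w.
Proof.
rewrite -(big_mkord xpredT (fun j => 'i ^+ j / 4 * ((x + 'i ^+ j * z) * (y + (- 'i) ^+ j * w)))).
rewrite !big_nat_recr//= big_geq// add0r.
set i := 'i : C; have i2 : i ^+ 2 = -1 by rewrite /i sqrCi.
have -> : i ^+ 3 = - i by rewrite exprS i2 mulrN1.
have -> : (- i) ^+ 3 = i by rewrite exprS sqrrN i2 mulrN1 opprK.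
rewrite sqrrN i2 !expr0 !expr1.
transitivity (x * w + (i ^+ 2 + 1) * (z * y - x * w) / 2); last first.
  by rewrite i2 addNr mul0r mul0r addr0.
by field.
Qed.

Lemma polarization k (r s a b : 'I_k) :
  \sum_(j < 4) 'i ^+ j / 4 * (polar_vec r s j a 0 * Num.conj (polar_vec r s j b 0))
    = (a == r)%:R * (b == s)%:R :> C.
Proof.
have vE j c : polar_vec r s j c 0 = (c == r)%:R + 'i ^+ j * (c == s)%:R.
  by rewrite /polar_vec !mxE !andbT.
rewrite -[RHS](sum_polarization _ (b == r)%:R (a == s)%:R); apply: eq_bigr => j _.
by rewrite !vE rmorphD rmorphM rmorphXn !rmorph_nat /= conjCi.
Qed.

Definition polar_tens (r s : 'I_#|mindex n d|) (f : {ffun 'I_n.+1 -> 'I_4}) : MX :=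
  tens (fun i => \matrix_(k, l)
    (polar_vec ((enum_val r : mindex n d) i) ((enum_val s : mindex n d) i) (f i) k 0 *
     Num.conj (polar_vec ((enum_val r : mindex n d) i) ((enum_val s : mindex n d) i) (f i) l 0))).

(** A matrix unit of the whole space is a tensor of matrix units; polarizing each factor and
    expanding the product writes it through psd tensors. *)
Lemma mx_polar_tens M : M = \sum_r \sum_s \sum_(f : {ffun 'I_n.+1 -> 'I_4})
  (M r s * \prod_i ('i ^+ f i / 4)) *: polar_tens r s f.
Proof.
apply/matrixP => a b; rewrite summxE.
transitivity (\sum_r \sum_s M r s * ((a == r)%:R * (b == s)%:R)).
  rewrite (bigD1 a)//= (bigD1 b)//= !eqxx !mulr1 big1 ?addr0 => [|s /negPf sb].
    rewrite big1 ?addr0// => r /negPf ra; rewrite big1// => s _.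
    by rewrite eq_sym ra mul0r mulr0.
  by rewrite [b == s]eq_sym sb !mulr0.
apply: eq_bigr => r _; rewrite summxE; apply: eq_bigr => s _; rewrite summxE.
rewrite -!prod_mindex_eq -big_split /=.
under eq_bigr do rewrite -polarization.
rewrite bigA_distr_bigA /= mulr_sumr; apply: eq_bigr => f _.
rewrite !mxE -mulrA -big_split /=; congr (_ * _); apply: eq_bigr => i _.
by rewrite !mxE.
Qed.

Lemma polar_tens_hermitian r s f : is_hermitian (polar_tens r s f).
Proof. by apply: tens_hermitian => i; apply/psd_hermitian/psd_rank1. Qed.

(** M is half the sum of its expansion and the adjoint of that expansion; as the tensors are
    Hermitian, the coefficients become real parts. *)
Lemma hermitian_polar_tens M : is_hermitian M ->
  M = \sum_r \sum_s \sum_(f : {ffun 'I_n.+1 -> 'I_4})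
    rC (complex.Re (M r s * \prod_i ('i ^+ f i / 4))) *: polar_tens r s f.
Proof.
move=> hM; apply: (@scalerI _ _ (2 : C)) => //.
rewrite [LHS]scaler_nat mulr2n -{1}hM {1 2}[M]mx_polar_tens /adjmx.
rewrite -/(adjmx _).
have adjS I (F : I -> MX) (s : seq I) : adjmx (\sum_(i <- s) F i) = \sum_(i <- s) adjmx (F i).
  by apply: big_morph; [exact: adjmxD|exact: adjmx0].
rewrite adjS -big_split scaler_sumr; apply: eq_bigr => r _ /=.
rewrite adjS -big_split scaler_sumr; apply: eq_bigr => s _ /=.
rewrite adjS -big_split scaler_sumr; apply: eq_bigr => f _ /=.
set z := _ * _; rewrite scalerA -addcJ scalerDl addrC; congr (_ + _).
apply/matrixP => a b; rewrite adjmxE [in LHS]mxE [in RHS]mxE rmorphM.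
by rewrite -[in RHS](polar_tens_hermitian r s f) [in RHS]adjmxE.
Qed.

(** Nonemptiness of the set whose infimum is [mu p M]; the empty set would have infimum 0 by
    convention, with no feasible [l] near it. *)
Definition gaugeable p M := exists l : R, 0 < l /\ Bp p (rC l^-1 *: M).

Lemma gaugeableD p M1 M2 : gaugeable p M1 -> gaugeable p M2 -> gaugeable p (M1 + M2).
Proof.
move=> [l1 [l10 [k1 [w1 [P1 [w10 w11 PP1 E1]]]]]] [l2 [l20 [k2 [w2 [P2 [w20 w21 PP2 E2]]]]]].
have s0 : 0 < l1 + l2 by rewrite addr_gt0.
exists (l1 + l2); split=> //; exists (k1 + k2)%N.
exists (fun j => match fintype.split j with
   | inl a => l1 / (l1 + l2) * w1 a | inr b => l2 / (l1 + l2) * w2 b end).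
exists (fun j => match fintype.split j with inl a => P1 a | inr b => P2 b end).
have spl a : fintype.split (lshift k2 a) = inl a by exact: (unsplitK (inl a)).
have spr b : fintype.split (rshift k1 b) = inr b by exact: (unsplitK (inr b)).
split.
- by move=> j; case: fintype.split => a; rewrite mulr_ge0// divr_ge0// ltW.
- rewrite big_split_ord /=; under eq_bigr do rewrite spl.
  under [X in _ + X]eq_bigr do rewrite spr.
  by rewrite -!mulr_sumr w11 w21 !mulr1 -mulrDl mulfV// gt_eqF.
- by move=> j; case: fintype.split.
rewrite big_split_ord /=; under eq_bigr do rewrite spl rmorphM /= -scalerA.
under [X in _ = _ + X]eq_bigr do rewrite spr rmorphM /= -scalerA.
rewrite -!scaler_sumr -E1 -E2 !scalerA -!rmorphM /= scalerDr.
by congr (rC _ *: _ + rC _ *: _); field; rewrite !gt_eqF.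
Qed.

Lemma gaugeable_tens (p t : R) rho : 0 < p -> (forall i, is_psd (rho i)) ->
  gaugeable p (rC t *: tens rho).
Proof.
move=> p0 pr; have h : is_hermitian (tens rho).
  by apply: tens_hermitian => i; exact: psd_hermitian.
set T := trpow p (tens rho); have T0 : 0 <= T := trpow_ge0 p h.
set N := T `^ p^-1 + 1; have N0 : 0 < N by rewrite ltr_wpDl ?powR_ge0.
have t0 := normr_ge0 t.
(* The summands 1 here and in [N] keep [l] positive when t or the tensor is 0. The scalar $|t|/l$
   will go into the factor at vertex 0, and the sign of t into the sign allowed by [Pp]. *)
set l := (`|t| + 1) * N; have l0 : 0 < l by rewrite mulr_gt0// ltr_wpDl.
exists l; split=> //; exists 1%N, (fun=> 1), (fun=> rC l^-1 *: (rC t *: tens rho)).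
split=> //; rewrite ?big_ord1 ?rmorph1 ?scale1r// => _.
have tl0 : 0 <= `|t| / l by rewrite divr_ge0// ltW.
have E : tens (fun i => rC (if i == ord0 then `|t| / l else 1) *: rho i)
    = rC (`|t| / l) *: tens rho.
  rewrite (tens_scale (fun i => rC (if i == ord0 then _ else _))); congr (_ *: _).
  by rewrite big_ord_recl eqxx big1 ?mulr1.
exists (t < 0), (fun i => rC (if i == ord0 then `|t| / l else 1) *: rho i); split.
- by move=> i; apply: psdZ => //; case: ifP.
- rewrite E schatten_leP//; last exact: hermitianZ.
  rewrite trpowZ// powR1 ger0_norm// -/T.
  have -> : T = (T `^ p^-1) `^ p by rewrite -powRrM mulVf ?gt_eqF// powRr1.
  rewrite -powRM ?powR_ge0//.
  have <- : 1 `^ p = 1 :> R by rewrite powR1.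
  apply: ge0_ler_powR; rewrite ?nnegrE ?(ltW p0)// ?(mulr_ge0 tl0) ?powR_ge0//.
  rewrite mulrAC ler_pdivrMr// mul1r /l /N; set z := T `^ _.
  have z0 : 0 <= z by exact: powR_ge0.
  by have := mulr_ge0 t0 z0; lra.
rewrite E !scalerA -rmorphM /=; congr (_ *: _).
case: (ltP t 0) => [t_lt|t_ge] /=.
  by rewrite expr1 ltr0_norm// mulN1r -rmorphN /=; congr (rC _); ring.
by rewrite expr0 ger0_norm// mul1r mulrC.
Qed.

Lemma hermitian_gaugeable p M : 0 < p -> is_hermitian M -> gaugeable p M.
Proof.
move=> p0 /hermitian_polar_tens ->.
have g0 : gaugeable p 0.
  rewrite -(scale0r (tens (fun i => 0))) -(rmorph0 (real_complex R)).
  by apply: gaugeable_tens => // i; exact: psd0.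
do 3!(apply: big_ind => [//|? ? |? _]; first exact: gaugeableD).
by apply: gaugeable_tens => // i; exact: psd_rank1.
Qed.

Lemma mu_ge0 p M : 0 < p -> is_hermitian M -> 0 <= mu p M.
Proof.
move=> p0 /(hermitian_gaugeable p0) gM.
by apply: lb_le_inf => [//|l [/ltW]].
Qed.

Lemma mu_lt p M (t : R) : 0 < p -> is_hermitian M -> mu p M < t ->
  exists l : R, [/\ 0 < l, l < t & Bp p (rC l^-1 *: M)].
Proof.
move=> p0 hM mt; have [l0 [l00 l0B]] := hermitian_gaugeable p0 hM.
have hi : has_inf [set l : R | 0 < l /\ Bp p (rC l^-1 *: M)].
  split; first by exists l0.
  by exists 0 => l [/ltW].
have e0 : 0 < t - mu p M by rewrite subr_gt0.
have [l [l1 l2] l3] := inf_adherent e0 hi.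
by exists l; split=> //; move: l3; rewrite -/(mu p M) addrC subrK.
Qed.

End Tensors.

(** * Group action and decompositions of orbit sums *)

Section GroupAction.
Variable R : realType.
Local Notation C := R[i].
Local Notation rC x := (real_complex R x).
Variables (n : nat) (d : 'I_n.+1 -> nat).
Variables (gT : finGroupType) (ai : gT -> 'I_n.+1 -> 'I_n.+1).
Hypotheses (act_ai : is_left_action ai) (d_inv : forall g i, d (ai g i) = d i).
Local Notation N := #|mindex n d|.
Local Notation MX := 'M[C]_N.
Local Notation family_mx := (forall i : 'I_n.+1, 'M[C]_(d i)).

Lemma aiK g : cancel (ai g) (ai g^-1%g).
Proof. by move=> i; case: act_ai => a1 aM; rewrite -aM mulVg a1. Qed.

Lemma aiVK g : cancel (ai g^-1%g) (ai g).
Proof. by move=> i; case: act_ai => a1 aM; rewrite -aM mulgV a1. Qed.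

Lemma mindex_eq_val (x : mindex n d) i j : i = j -> x i = x j :> nat.
Proof. by move=> ->. Qed.

Lemma family_eq_entry (rho : family_mx) i j (r s : 'I_(d i)) (r' s' : 'I_(d j)) :
  i = j -> r = r' :> nat -> s = s' :> nat -> rho i r s = rho j r' s'.
Proof. by move=> ij; subst j => /val_inj -> /val_inj ->. Qed.

Definition mindex_act g (x : mindex n d) : mindex n d :=
  finfun (fun i => cast_ord (d_inv g^-1%g i) (x (ai g^-1%g i))).

Lemma mindex_actE g x i : mindex_act g x i = x (ai g^-1%g i) :> nat.
Proof. by rewrite ffunE. Qed.

Lemma mindex_act_inj g : injective (mindex_act g).
Proof.
move=> x y H; apply/ffunP => i; apply: val_inj => /=.
have := mindex_actE g x (ai g i); rewrite H mindex_actE.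
by rewrite (mindex_eq_val x (aiK g i)) (mindex_eq_val y (aiK g i)).
Qed.

Definition idx_act g (a : 'I_N) : 'I_N := enum_rank (mindex_act g (enum_val a)).

Lemma idx_act_inj g : injective (idx_act g).
Proof. by move=> a b /enum_rank_inj/mindex_act_inj/enum_val_inj. Qed.

Definition mx_act g (M : MX) : MX := \matrix_(a, b) M (idx_act g a) (idx_act g b).

Lemma mx_act_inv g M : G_invariant ai M -> mx_act g M = M.
Proof.
move=> invM; apply/matrixP => a b; rewrite mxE; apply/esym/(invM g) => i.
  by rewrite enum_rankK mindex_actE.
by rewrite enum_rankK mindex_actE.
Qed.

(** The group permutes multi-indices, so it acts by conjugation with permutation matrices. These are
    unitary, hence trace powers are invariant. *)
Lemma mx_act_perm g M : let s := perm (@idx_act_inj g) in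
  mx_act g M = perm_mx s *m M *m adjmx (perm_mx s).
Proof.
move=> s; rewrite /adjmx map_perm_mx tr_perm_mx -row_permE -[s in RHS]invgK.
rewrite invgK -col_permE.
by apply/matrixP => a b; rewrite !mxE !permE.
Qed.

Lemma trpow_mx_act p g M : is_hermitian M -> trpow p (mx_act g M) = trpow p M.
Proof.
move=> hM; rewrite mx_act_perm trpow_conj// /unitary /adjmx map_perm_mx.
by rewrite tr_perm_mx -perm_mxM mulgV perm_mx1.
Qed.

Lemma mx_act_hermitian g M : is_hermitian M -> is_hermitian (mx_act g M).
Proof.
by move=> hM; apply/matrixP => a b; rewrite adjmxE !mxE -adjmxE hM.
Qed.

Lemma mx_actB g M M' : mx_act g (M - M') = mx_act g M - mx_act g M'.
Proof. by apply/matrixP => a b; rewrite !mxE. Qed.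

Lemma mx_actZ g (z : C) M : mx_act g (z *: M) = z *: mx_act g M.
Proof. by apply/matrixP => a b; rewrite !mxE. Qed.

Lemma mx_act_sum g I (r : seq I) (F : I -> MX) :
  mx_act g (\sum_(i <- r) F i) = \sum_(i <- r) mx_act g (F i).
Proof.
by apply/matrixP => a b; rewrite mxE !summxE; apply: eq_bigr => i _; rewrite mxE.
Qed.

Definition family_act g (rho : family_mx) : family_mx := fun i =>
  \matrix_(r, s) rho (ai g i) (cast_ord (esym (d_inv g i)) r) (cast_ord (esym (d_inv g i)) s).

Lemma mx_act_tens g (rho : family_mx) :
  mx_act g (tens rho) = tens (family_act g rho).
Proof.
apply/matrixP => a b; rewrite !mxE (reindex (ai g)) /=; last first.
  by exists (ai g^-1%g) => i _; [exact: aiK|exact: aiVK].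
apply: eq_bigr => i _; rewrite mxE !enum_rankK.
by apply: family_eq_entry => //=; rewrite mindex_actE (mindex_eq_val _ (aiK g i)).
Qed.

Section Average.
Variable p : R.
Hypothesis p1 : 1 < p.

Lemma trpow_average D : is_hermitian D ->
  trpow p (\sum_(g : gT) rC (#|gT|%:R^-1) *: mx_act g D) <= trpow p D.
Proof.
move=> hD; have G0 : (#|gT|%:R : R) != 0 by rewrite pnatr_eq0 -lt0n (cardD1 1%g).
have := @trpow_jensen R N p gT (fun=> #|gT|%:R^-1) (fun g => mx_act g D) p1.
move/(_ _ _ _)/le_trans; apply.
- by move=> g; rewrite invr_ge0.
- by rewrite sumr_const -[_^-1 *+ _]mulr_natr mulVf.
- by move=> g; exact: mx_act_hermitian.
under eq_bigr do rewrite trpow_mx_act//.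
by rewrite sumr_const -[_ *+ #|_|]mulr_natr mulrAC mulVf// mul1r.
Qed.

End Average.
End GroupAction.

Section FreeAction.
Variables (gT : finGroupType) (Ft : finType) (aF : gT -> Ft -> Ft).
Hypotheses (act_aF : is_left_action aF) (free_aF : free_action aF).

(** The predicate describes the orbit of x, so [pick] returns the same point on the whole orbit; the
    default is never reached, as x lies in its own orbit. *)
Let orbit_repr (x : Ft) : Ft := odflt x [pick y | [exists g, aF g x == y]].

(** [tau x] carries the representative of the orbit to x. By freeness only one element does so, and
    g times [tau x] carries the representative to g x. *)
Lemma equivariant_to_group : exists tau : Ft -> gT,
  forall g x, tau (aF g x) = (g * tau x)%g.
Proof.
have [a1 aM] := act_aF.
have rE g x : orbit_repr (aF g x) = orbit_repr x.
  rewrite /orbit_repr.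
  have E : [pick y | [exists h, aF h (aF g x) == y]] = [pick y | [exists h, aF h x == y]].
    apply: eq_pick => y; apply/existsP/existsP => -[h /eqP <-].
      by exists (h * g)%g; rewrite aM.
    by exists (h * g^-1)%g; rewrite -aM mulgKV.
  rewrite E; case: pickP => [//|/(_ x)/existsP[]].
  by exists 1%g; rewrite a1.
have rP x : exists g, aF g (orbit_repr x) = x.
  rewrite /orbit_repr; case: pickP => [y /existsP[g /eqP <-]|/(_ x)/existsP[]] /=.
    by exists g^-1%g; rewrite -aM mulVg a1.
  by exists 1%g; rewrite a1.
have [tau tauP] := choice rP; exists tau => g x.
have H : aF (tau (aF g x)) (orbit_repr x) = aF (g * tau x)%g (orbit_repr x).
  by rewrite aM tauP -(rE g) tauP.
have : aF ((g * tau x)^-1 * tau (aF g x))%g (orbit_repr x) = orbit_repr x.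
  by rewrite aM H -aM mulVg a1.
by move=> /free_aF /(congr1 (fun u => (g * tau x) * u)%g); rewrite mulKVg mulg1.
Qed.

End FreeAction.

(** * Decomposing orbit sums of elementary tensors *)

Section Decomposition.
Variable R : realType.
Local Notation C := R[i].
Local Notation rC x := (real_complex R x).
Variables (n : nat) (Om : {set 'I_n.+1} -> nat).
Variables (gT : finGroupType) (ai : gT -> 'I_n.+1 -> 'I_n.+1).
Variables (Ft : finType) (c : Ft -> {set 'I_n.+1}) (aF : gT -> Ft -> Ft).
Variable d : 'I_n.+1 -> nat.
Hypotheses (wscO : is_wsc Om) (connO : wsc_connected Om) (multO : facet_multiset Om c).
Hypotheses (actO : wsc_action Om ai c aF) (free_aF : free_action aF).
Hypothesis d_inv : forall (g : gT) (i : 'I_n.+1), d (ai g i) = d i.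
Local Notation family_mx := (forall i : 'I_n.+1, 'M[C]_(d i)).

Lemma facet_of_element x : is_facet Om (c x).
Proof.
have := multO (c x); case: ifP => // _ /eqP; rewrite cards_eq0 => /eqP/setP/(_ x).
by rewrite !inE eqxx.
Qed.

Lemma element_of_facet F : is_facet Om F -> exists x, c x = F.
Proof.
move=> fF; have /andP[sF _] := fF; have := multO F; rewrite fF => E.
have : (0 < #|[set x | c x == F]|)%N by rewrite E lt0n.
by rewrite card_gt0 => /set0Pn[x]; rewrite inE => /eqP <-; exists x.
Qed.

(** The empty set is no facet, being properly contained in a singleton simplex. Hence a labelling is
    determined by its restrictions to the vertices. *)
Lemma element_has_vertex x : exists i, i \in c x.
Proof.
have /andP[_ /forallP H] := facet_of_element x.
apply/set0Pn/eqP => cx; have := H [set ord0].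
rewrite /is_simplex (proj2 wscO) cx finset.sub0set /= => /eqP/setP/(_ ord0).
by rewrite !inE eqxx.
Qed.

Lemma neighbours_element i j : neighbours Om i j -> exists x, (i \in c x) && (j \in c x).
Proof.
move=> /existsP[F /and3P[fF iF jF]]; have [x cx] := element_of_facet fF.
by exists x; rewrite cx iF jF.
Qed.

Variables (K : nat) (z : 'I_K -> C) (rho : 'I_K -> family_mx).
Local Notation Q := ('I_K * gT)%type.

(** Each pair q of a sample and a group element has its own labelling [al q], and [v i] collects the
    factors [X q i] of all q whose labelling restricts to the given one. Expanding the tensor
    product allows a separate q at each vertex; a shared element forces neighbours to agree, and
    connectedness leaves a single q. *)
Lemma symmetrized_decomp : exists v, @is_decomp R n d gT ai Ft c aF #|{: Q}| v
  (\sum_t \sum_g z t *: mx_act d_inv g (tens (rho t))).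
Proof.
have [act_ai _ act_aF cF] := actO; have [a1 aM] := act_ai.
have [tau tauM] := equivariant_to_group act_aF free_aF.
(* The scalar z t is spread over the n+1 tensor factors, so that they stay
   equivariant. *)
pose om (t : 'I_K) : C := n.+1.-root (z t).
pose X (q : Q) : family_mx := fun i => om q.1 *: family_act d_inv q.2 (rho q.1) i.
pose al (q : Q) : {ffun Ft -> 'I_#|{: Q}|} := [ffun x => enum_rank (q.1, (q.2 * tau x)%g)].
have al_inj q q' x : al q x = al q' x -> q = q'.
  rewrite !ffunE => /enum_rank_inj []; case: q q' => [t h] [t' h'] /= ->.
  by move/mulIg => ->.
pose v i (be : {ffun {x : Ft | i \in c x} -> 'I_#|{: Q}|}) : 'M[C]_(d i) :=
  \sum_(q | restr c (al q) i == be) X q i.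
have restrE (f : {ffun Ft -> 'I_#|{: Q}|}) i u : restr c f i u = f (val u).
  by rewrite ffunE.
exists v; split; last first.
  move=> i g be be' Hbe r s r' s' rr' ss'; rewrite !summxE.
  (* Right translation by $g^{-1}$ matches the label of q at x with that of the translated pair at g
     x. *)
  rewrite [RHS](reindex (fun q : Q => (q.1, q.2 * g^-1)%g)) /=; last first.
    by exists (fun q : Q => (q.1, q.2 * g)%g) => -[t h] _; rewrite /= ?mulgKV ?mulgK.
  have alE (q : Q) x : al (q.1, (q.2 * g^-1)%g) (aF g x) = al q x.
    by rewrite !ffunE tauM -mulgA mulKg.
  apply: eq_big => [q|q _]; last first.
    rewrite !mxE /=; congr (_ * _); apply: family_eq_entry => //.
    by rewrite -aM mulgKV.
  apply/eqP/eqP => [E|E].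
    apply/ffunP => y; rewrite restrE.
    have hx : i \in c (aF g^-1%g (val y)).
      by rewrite cF -{1}(aiK act_ai g i) imset_f ?(valP y).
    have yE : val y = aF g (aF g^-1%g (val y)).
      by case: act_aF => b1 bM; rewrite -bM mulgV b1.
    rewrite (Hbe (exist (fun x => is_true (i \in c x)) _ hx) y yE) -E restrE /=.
    by rewrite [in LHS]yE alE.
  apply/ffunP => x; rewrite restrE.
  have hy : ai g i \in c (aF g (val x)) by rewrite cF imset_f ?(valP x).
  by rewrite -(Hbe x (exist (fun x => is_true (ai g i \in c x)) _ hy) erefl) -E restrE /= alE.
transitivity (\sum_(q : Q) tens (X q)).
  rewrite pair_big; apply: eq_bigr => -[t h] _ /=.
  rewrite (tens_scale (fun=> om t)) prodr_const card_ord /om rootCK//.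
  by rewrite mx_act_tens.
transitivity (\sum_(a : {ffun Ft -> 'I_#|{: Q}|}) \sum_(q | al q == a) tens (X q)).
  rewrite (exchange_big_dep predT)//=; apply: eq_bigr => q _.
  by rewrite (big_pred1 (al q)) // => a; rewrite eq_sym.
apply: eq_bigr => a _; apply/matrixP => r s; rewrite summxE [RHS]mxE.
under [RHS]eq_bigr do rewrite summxE.
rewrite bigA_distr_big_dep.
rewrite (reindex_onto (fun q : Q => [ffun _ : 'I_n.+1 => q]) (fun f => f ord0)) /=; last first.
  move=> f /familyP famf; apply/ffunP => i; rewrite ffunE.
  have fE i0 x : i0 \in c x -> al (f i0) x = a x.
    move=> ix; have /eqP/ffunP/(_ (exist (fun x => is_true (i0 \in c x)) x ix)) := famf i0.
    by rewrite !restrE.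
  have cl : fingraph.closed (neighbours Om) [pred j | f j == f ord0].
    move=> i1 i2 /neighbours_element [x /andP[x1 x2]]; rewrite !inE.
    suff -> : f i1 = f i2 by [].
    by apply: (al_inj _ _ x); rewrite !fE.
  have := closed_connect cl (connO ord0 i); rewrite !inE eqxx.
  by move=> /esym/eqP.
apply: eq_big => [q|q _]; last first.
  by rewrite mxE; apply: eq_bigr => i _; rewrite ffunE.
rewrite ffunE eqxx andbT; apply/eqP/familyP => [<- i|H].
  by rewrite ffunE unfold_in eqxx.
apply/ffunP => x; have [i ix] := element_has_vertex x.
have := H i; rewrite ffunE unfold_in => /eqP/ffunP/(_ (exist (fun x => is_true (i \in c x)) x ix)).
by rewrite !restrE.
Qed.

End Decomposition.

(** * The approximate rank *)

Section Rates.
Variable R : realType.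
Implicit Types (p u l eps k : R).

(** Raising the hypothesis to the power p - 1 turns the exponent p/(p-1) into p. As $C_p^{p-1} = 2^p
    e^{2p}/p$, the claim reduces to $2p \le e^{2p}$, which follows from $p < 2$ and $e^2 \ge 4$. *)
Lemma rate_lt2 p u l eps k : 1 < p < 2 -> 0 < l -> l <= 2 * u -> 0 < eps -> 0 < k ->
  Cp p * (2 * u / eps) `^ (p / (p - 1)) <= k ->
  (l / k) `^ p * (2 * 2 `^ p * k) <= eps `^ p.
Proof.
move=> /andP[p1 p2] l0 lu eps0 k0 H.
have p0 : 0 < p by lra. have p10 : 0 < p - 1 by lra.
set s := l / eps; have s0 : 0 < s by rewrite divr_gt0.
have su : s <= 2 * u / eps by rewrite ler_pM2r ?invr_gt0.
set e2 : R := expR 1 ^+ 2; have e24 : 4 <= e2 by case: (@expR1_sqr R).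
set A := 2 * e2 / p `^ p^-1.
have A0 : 0 <= A by rewrite divr_ge0 ?powR_ge0//; lra.
have q0 : 0 <= p / (p - 1) by rewrite divr_ge0 ?ltW.
have {}H : (A * s) `^ (p / (p - 1)) <= k.
  apply: le_trans H; rewrite powRM ?(ltW s0)//; apply: ler_wpM2l; first exact: powR_ge0.
  by apply: ge0_ler_powR; rewrite ?nnegrE ?(ltW s0)// (le_trans (ltW s0)).
have {}H : A `^ p * s `^ p <= k `^ (p - 1).
  rewrite -powRM ?(ltW s0)//.
  have := ge0_ler_powR (ltW p10) _ _ H; rewrite !nnegrE powR_ge0 (ltW k0) => /(_ isT isT).
  by rewrite -powRrM divfK// gt_eqF.
have AE : A `^ p = 2 `^ p * e2 `^ p / p.
  rewrite /A powRM ?invr_ge0 ?powR_ge0//; last by rewrite mulr_ge0//; lra.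
  rewrite powRM//; last by lra.
  congr (_ * _); rewrite -powR_inv1 ?powR_ge0// -!powRrM.
  by rewrite mulN1r mulrN mulVf ?gt_eqF// powR_inv1// ltW.
have e2p : 2 * p <= e2 `^ p.
  apply: (@le_trans _ _ e2); first by lra.
  by apply: le1r_powR; lra.
have {}H : 2 * 2 `^ p * s `^ p <= k `^ (p - 1).
  apply: le_trans H; rewrite AE; apply: ler_wpM2r; first exact: powR_ge0.
  rewrite mulrC -mulrA; apply: ler_wpM2l; first exact: powR_ge0.
  by rewrite ler_pdivlMr.
have -> : l / k = s * eps / k by rewrite /s divfK ?gt_eqF.
rewrite powRM ?invr_ge0 ?(ltW k0)//; last by rewrite mulr_ge0 ?ltW.
rewrite powRM ?(ltW s0) ?(ltW eps0)//.
have -> : k^-1 `^ p = (k * k `^ (p - 1))^-1.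
  by rewrite mulr_powRB1 ?(ltW k0)// -(powR_inv1 (ltW k0)) -powRrM mulN1r powRN.
have kp0 : 0 < k `^ (p - 1) by rewrite powR_gt0.
have -> : s `^ p * eps `^ p * (k * k `^ (p - 1))^-1 * (2 * 2 `^ p * k)
    = eps `^ p * (2 * 2 `^ p * s `^ p / k `^ (p - 1)).
  by field; rewrite !gt_eqF.
by rewrite -[leRHS]mulr1 ler_wpM2l ?powR_ge0// ler_pdivrMr// mul1r.
Qed.

(** Both sides are powers with exponent p/2, so it is enough to compare the bases: $D_p l^2/k \le
    \epsilon^2$. *)
Lemma rate_ge2 p u l eps k : 2 <= p -> 0 < l -> l <= 2 * u -> 0 < eps -> 0 < k ->
  Dp p * (2 * u / eps) `^ 2 <= k ->
  (l / k) `^ p * (2 * expR 1 ^+ 4 * (p - 1) * k) `^ (p / 2) <= eps `^ p.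
Proof.
move=> p2 l0 lu eps0 k0 H.
have half (x : R) : 0 < x -> x `^ p = (x ^+ 2) `^ (p / 2).
  by move=> x0; rewrite -normr_powR_half gtr0_norm.
rewrite !half ?divr_gt0//; set D := 2 * _ * _.
have D0 : 0 <= D by rewrite !mulr_ge0 ?exprn_ge0 ?expR_ge0//; lra.
rewrite -powRM ?sqr_ge0 ?(mulr_ge0 D0 (ltW k0))//.
have u0 : 0 <= 2 * u / eps by rewrite divr_ge0 ?(ltW eps0)// (le_trans (ltW l0)).
have {}H : D * l ^+ 2 <= k * eps ^+ 2.
  have e2 : 0 < eps ^+ 2 by rewrite exprn_gt0.
  rewrite -ler_pdivrMr// -mulrA -expr_div_n; apply: le_trans H.
  have -> : D = Dp p by rewrite /D /Dp mulrAC.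
  rewrite powR_mulrn//; apply: ler_wpM2l.
    by rewrite /Dp mulrAC.
  have le0 : 0 <= l / eps := divr_ge0 (ltW l0) (ltW eps0).
  by rewrite ler_sqr ?nnegrE// ler_pM2r ?invr_gt0.
apply: ge0_ler_powR; rewrite ?nnegrE ?sqr_ge0//.
- by rewrite divr_ge0//; lra.
- by rewrite mulr_ge0 ?sqr_ge0// mulr_ge0// ltW.
have -> : (l / k) ^+ 2 * (D * k) = D * l ^+ 2 / k by field; rewrite gt_eqF.
by rewrite ler_pdivrMr// [leRHS]mulrC.
Qed.

End Rates.

Section ApproxRank.
Variable R : realType.
Local Notation C := R[i].
Local Notation rC x := (real_complex R x).
Variables (n : nat) (Om : {set 'I_n.+1} -> nat).
Variables (gT : finGroupType) (ai : gT -> 'I_n.+1 -> 'I_n.+1).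
Variables (Ft : finType) (c : Ft -> {set 'I_n.+1}) (aF : gT -> Ft -> Ft).
Variables (d : 'I_n.+1 -> nat) (eps p : R) (M : 'M[C]_#|mindex n d|).
Hypotheses (wscO : is_wsc Om) (connO : wsc_connected Om) (multO : facet_multiset Om c).
Hypotheses (actO : wsc_action Om ai c aF) (free_aF : free_action aF).
Hypothesis d_inv : forall (g : gT) (i : 'I_n.+1), d (ai g i) = d i.
Hypotheses (eps0 : 0 < eps) (hM : is_hermitian M) (invM : G_invariant ai M).
Hypothesis p1 : 1 < p.
Local Notation MX := 'M[C]_#|mindex n d|.

Let p0 : 0 < p. Proof. exact: lt_trans ltr01 p1. Qed.

Lemma approx_rank_le_symmetrized K (z : 'I_K -> C)
    (rho : 'I_K -> forall i : 'I_n.+1, 'M[C]_(d i)) :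
  schatten p (M - \sum_t \sum_g z t *: mx_act d_inv g (tens (rho t))) <= eps ->
  (approx_rankOG ai c aF eps p M <= (K%:R * #|gT|%:R)%:E)%E.
Proof.
move=> H; set N := \sum_t _ in H.
apply: (@le_trans _ _ (rankOG ai c aF N)); first by apply: ereal_inf_lbound; exists N.
apply: ereal_inf_lbound; exists #|{: 'I_K * gT}|.
  exact: symmetrized_decomp wscO connO multO actO free_aF d_inv K z rho.
by rewrite card_prod card_ord natrM.
Qed.

(** Rank 0 leaves only the empty sum, so the zero matrix must approximate M. A feasible [l] below
    [eps] shows that it does, because M/l has norm at most 1. *)
Lemma approx_rank_le0 : mu p M = 0 -> (approx_rankOG ai c aF eps p M <= 0)%E.
Proof.
move=> mu0; have [l [l0 le [k [w [P [w0 w1 PP ME]]]]]] : exists l : R,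
    [/\ 0 < l, l < eps & Bp p (rC l^-1 *: M)] by apply: mu_lt; rewrite ?mu0.
have hP j := Pp_hermitian (PP j); have nP j := Pp_trpow p0 (PP j).
have := @approx_rank_le_symmetrized 0 (fun=> 0) (fun _ _ => 0).
rewrite big_ord0 subr0 mul0r; apply; rewrite schatten_leP ?(ltW eps0)//.
have -> : M = rC l *: (\sum_j rC (w j) *: P j).
  by rewrite -ME scalerA -rmorphM mulfV ?gt_eqF// rmorph1 scale1r.
rewrite trpowZ; last exact: hermitian_mean.
rewrite gtr0_norm//.
apply: (@le_trans _ _ (l `^ p * 1)).
  by rewrite ler_wpM2l ?powR_ge0// trpow_mean.
by rewrite mulr1 ge0_ler_powR ?nnegrE ?(ltW p0) ?(ltW l0) ?(ltW eps0) ?(ltW le).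
Qed.

Lemma approx_rank_le_sampled (K k : nat) (l : R) (P : 'I_k -> MX) (f : nat -> 'I_k) :
  (0 < K)%N -> 0 < l -> (forall j, Pp p (P j)) ->
  (l / K%:R) `^ p * trpow p (\sum_(t < K) (P (f t) - rC l^-1 *: M)) <= eps `^ p ->
  (approx_rankOG ai c aF eps p M <= (K%:R * #|gT|%:R)%:E)%E.
Proof.
move=> K0 l0 PP H; have hP j := Pp_hermitian (PP j).
have /choice[br brE] : forall j, exists br : bool * (forall i : 'I_n.+1, 'M[C]_(d i)),
    P j = (-1) ^+ br.1 *: tens br.2.
  by move=> j; have [b [rho [_ _ ->]]] := PP j; exists (b, rho).
have [act_ai _ _ _] := actO.
have G0 : (#|gT|%:R : R) != 0 by rewrite pnatr_eq0 -lt0n (cardD1 1%g).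
have K0' : (K%:R : R) != 0 by rewrite pnatr_eq0 -lt0n.
apply: (@approx_rank_le_symmetrized K
  (fun t => rC (#|gT|%:R^-1) * (rC (l / K%:R) * (-1) ^+ (br (f t)).1))
  (fun t => (br (f t)).2)).
set D := M - rC (l / K%:R) *: \sum_(t < K) P (f t).
have hD : is_hermitian D.
  by apply: hermitianB => //; apply: hermitianZ; apply: hermitian_sum.
(* M equals its own average over the group, so the error of the averaged approximant is the average
   of the error [D]. *)
have -> : M - \sum_(t < K) \sum_g (rC (#|gT|%:R^-1) * (rC (l / K%:R) * (-1) ^+ (br (f t)).1))
      *: mx_act d_inv g (tens (br (f t)).2)
    = \sum_(g : gT) rC (#|gT|%:R^-1) *: mx_act d_inv g D.
  under [RHS]eq_bigr do rewrite mx_actB (mx_act_inv _ _ invM) scalerBr.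
  rewrite sumrB sumr_const; congr (_ - _).
    rewrite -scaler_nat scalerA.
    by rewrite -(rmorph_nat (real_complex R)) -rmorphM /= mulfV// rmorph1 scale1r.
  rewrite exchange_big; apply: eq_bigr => g _ /=.
  rewrite mx_actZ mx_act_sum !scaler_sumr; apply: eq_bigr => t _.
  by rewrite brE mx_actZ !scalerA mulrA.
rewrite schatten_leP ?(ltW eps0)//; last first.
  apply: hermitian_sum => g _; apply: hermitianZ; exact: mx_act_hermitian.
apply: le_trans (trpow_average act_ai d_inv p1 hD) _; apply: le_trans H.
have -> : D = rC (- (l / K%:R)) *: \sum_(t < K) (P (f t) - rC l^-1 *: M).
  rewrite sumrB scalerBr sumr_const card_ord -[(_ *: M) *+ K]scaler_nat !scalerA.
  rewrite -(rmorph_nat (real_complex R)) -!rmorphM /=.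
  rewrite (_ : - (l / K%:R) * (K%:R / l) = -1); last by field; rewrite K0' gt_eqF.
  by rewrite !rmorphN rmorph1 !scaleNr scale1r opprK addrC.
rewrite trpowZ ?normrN ?ger0_norm ?divr_ge0 ?ler0n ?(ltW l0)//.
by apply: hermitian_sum => t _; apply: hermitianB => //; exact: hermitianZ.
Qed.

(** This is the part common to both ranges of p: x is the number under the ceiling, and the last
    premise asks for K points with small total deviation. A positive gauge lies strictly below its
    double, which supplies a feasible [l]; gauge 0 is left to [approx_rank_le0]. *)
Lemma approx_rank_le_ceil (x : R) : 0 <= x -> (0 < mu p M -> 0 < x) ->
  (forall (K k : nat) (l : R) (w : 'I_k -> R) (P : 'I_k -> MX),
     0 < K%:R :> R -> x <= K%:R -> 0 < l -> l <= 2 * mu p M ->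
     (forall j, 0 <= w j) -> \sum_j w j = 1 -> (forall j, is_hermitian (P j)) ->
     (forall j, trpow p (P j) <= 1) ->
     exists f : nat -> 'I_k, (l / K%:R) `^ p *
       trpow p (\sum_(t < K) (P (f t) - \sum_j rC (w j) *: P j)) <= eps `^ p) ->
  (approx_rankOG ai c aF eps p M <= ((Num.ceil x)%:~R * #|gT|%:R)%:E)%E.
Proof.
move=> x0 mux H.
have c0 : 0 <= Num.ceil x by rewrite ceil_ge0 (lt_le_trans _ x0)// ltrN10.
have cE : (Num.ceil x)%:~R = (`|Num.ceil x|%N)%:R :> R.
  by rewrite -[in LHS](gez0_abs c0).
have := mu_ge0 p0 hM; rewrite le_eqVlt => /orP[/eqP/esym m0|m0].
  apply: le_trans (approx_rank_le0 m0) _.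
  by rewrite lee_fin mulr_ge0 ?ler0n// ler0z.
have x0' := mux m0; have xK := ceil_ge x; rewrite cE in xK *.
have K0 : 0 < (`|Num.ceil x|%N)%:R :> R := lt_le_trans x0' xK.
have [l [l0 l2 [k [w [P [w0 w1 PP ME]]]]]] : exists l : R,
    [/\ 0 < l, l < 2 * mu p M & Bp p (rC l^-1 *: M)].
  by apply: mu_lt => //; rewrite mulr_natl mulr2n ltrDl.
have [f Hf] := H _ _ _ w P K0 xK l0 (ltW l2) w0 w1
  (fun j => Pp_hermitian (PP j)) (fun j => Pp_trpow p0 (PP j)).
apply: (@approx_rank_le_sampled _ k l P f) => //; last by rewrite ME.
by rewrite -(ltr0n R).
Qed.

End ApproxRank.

Theorem mainTheorem6 (R : realType) (n : nat) (Om : {set 'I_n.+1} -> nat)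
    (gT : finGroupType) (ai : gT -> 'I_n.+1 -> 'I_n.+1)
    (Ft : finType) (c : Ft -> {set 'I_n.+1}) (aF : gT -> Ft -> Ft)
    (d : 'I_n.+1 -> nat) (eps p : R) (M : 'M[R[i]]_#|mindex n d|) :
  is_wsc Om -> wsc_connected Om -> facet_multiset Om c ->
  wsc_action Om ai c aF -> free_action aF ->
  (forall (g : gT) (i : 'I_n.+1), d (ai g i) = d i) ->
  0 < eps -> is_hermitian M -> G_invariant ai M ->
  (1 < p <= 4 / 3 ->
     (approx_rankOG ai c aF eps p M <=
     ((Num.ceil (Cp p * powR (2 * mu p M / eps) (p / (p - 1))))%:~R
        * (#|gT|%:R : R))%:E)%E) /\
  ((p = 2 \/ 4 <= p) ->
     (approx_rankOG ai c aF eps p M <=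
     ((Num.ceil (Dp p * powR (2 * mu p M / eps) 2))%:~R
        * (#|gT|%:R : R))%:E)%E).
Proof.
move=> wscO connO multO actO free_aF d_inv eps0 hM invM; split.
  move=> /andP[p1 p43]; have p12 : 1 < p < 2 by apply/andP; split; lra.
  have e0 : 0 < expR 1 :> R := expR_gt0 1.
  have C0 : 0 < Cp p by rewrite powR_gt0// divr_gt0 ?powR_gt0 ?mulr_gt0 ?exprn_gt0//; lra.
  apply: (approx_rank_le_ceil wscO connO multO actO free_aF d_inv eps0 hM invM p1).
  - by rewrite mulr_ge0 ?powR_ge0 ?ltW.
  - by move=> m0; rewrite mulr_gt0// powR_gt0// divr_gt0// mulr_gt0.
  move=> K k l w P K0 xK l0 l2 w0 w1 hP nP.
  have p2 : p < 2 by lra.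
  have [f Hf] := greedy_lt2 p1 w0 w1 hP nP K p2; exists f.
  apply: le_trans (rate_lt2 p12 l0 l2 eps0 K0 xK).
  by rewrite ler_wpM2l ?powR_ge0.
move=> p24; have p2 : 2 <= p by case: p24 => [->|]; lra.
have p1 : 1 < p by lra.
have D0 : 0 < Dp p by rewrite !mulr_gt0 ?exprn_gt0 ?expR_gt0//; lra.
apply: (approx_rank_le_ceil wscO connO multO actO free_aF d_inv eps0 hM invM p1).
- by rewrite mulr_ge0 ?powR_ge0 ?ltW.
- by move=> m0; rewrite mulr_gt0// powR_gt0// divr_gt0// mulr_gt0.
move=> K k l w P K0 xK l0 l2 w0 w1 hP nP.
have [f [_ Hf]] := greedy_ge2 p1 w0 w1 hP nP K p2; exists f.
apply: le_trans (rate_ge2 p2 l0 l2 eps0 K0 xK).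
by rewrite ler_wpM2l ?powR_ge0.
Qed.
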